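(* Let $g\in\mathrm{GL}_2(\mathbb{R})$ and, for $R>0$, let $\mathcal{S}_R=\{\mathbf{v}\in\mathbb{Z}^2_{\mathrm{prim}}:\|g\mathbf{v}\|\le R\}$. Then the family $(\{\|g\mathbf{v}\|\})_{\mathbf{v}\in\mathcal{S}_R}$ of fractional parts is uniformly distributed as $R\to\infty$; that is, for all $0\le a<b\le1$, $$\lim_{R\to\infty}\frac{\#\{\mathbf{v}\in\mathcal{S}_R: a\le\{\|g\mathbf{v}\|\}<b\}}{\#\mathcal{S}_R}=b-a.$$
   Context: $\mathbb{Z}^2_{\mathrm{prim}}=\{(a,b)\in\mathbb{Z}^2:\gcd(a,b)=1\}$; $\|\cdot\|$ is the Euclidean norm on $\mathbb{R}^2$; for real $x$, $\{x\}=x-\lfloor x\rfloor$ is the fractional part of $x$. *)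

(* Defs.v *)
(* MathComp-Analysis; the real numbers are an arbitrary [R : realType]. *)
From mathcomp Require Import all_boot all_order all_algebra finmap.
From mathcomp Require Import all_classical all_reals all_analysis.
Set Implicit Arguments.
Unset Strict Implicit.
Unset Printing Implicit Defensive.
Import Order.TTheory GRing.Theory Num.Theory.
Import numFieldNormedType.Exports.
Local Open Scope classical_set_scope.
Local Open Scope ring_scope.

(* The library norm `|x| on matrices is the sup norm, hence this definition. *)
Definition euclidean_norm (R : realType) (n : nat) (x : 'cV[R]_n) : R :=
  Num.sqrt (\sum_(i < n) x i 0 ^+ 2).

Definition frac_part (R : realType) (x : R) : R := x - (Num.floor x)%:~R.

Definition Z2prim : set 'cV[int]_2 := [set v : 'cV[int]_2 | coprimez (v 0 0) (v 1 0)].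

Definition image_norm (R : realType) (g : 'M[R]_2) (v : 'cV[int]_2) : R :=
  euclidean_norm (g *m map_mx intr v).

Definition prim_ball (R : realType) (g : 'M[R]_2) (r : R) : set 'cV[int]_2 :=
  [set v : 'cV[int]_2 | Z2prim v /\ image_norm g v <= r].

(* [fset_set] of an infinite set is empty; this is only applied to subsets of
   [prim_ball g r] with [g] invertible, which are finite. *)
Definition set_card (T : choiceType) (A : set T) : nat := #|` fset_set A|.

(* Main.v *)
(* Put |v| for the Euclidean norm of g v. Sieving by one prime p after another turns a sum over
   lattice vectors not divisible by p into a difference of sums for g and p g, and few vectors
   are divisible by a large integer. So it suffices to show that, for every invertible g, the
   norms of all lattice vectors are equidistributed modulo 1.

   Let G be the 1-periodic primitive of the centred indicator of an arc of length c = l + s. If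
   a step h increases the norm by some eta in (0, s), then |.| and |. + h| stay inside the
   enlarged arc as soon as |.| lies in the arc of length l, whence
     eta * (1_arc(|v|) - c) <= G(|v + h|) - G(|v|).
   Summed over a ball against weights which vary slowly with v, the right-hand side telescopes
   up to o(r^2). By the pigeonhole principle the steps h can be chosen in a finite set, for all
   directions v except those almost orthogonal to one of these steps. This gives an upper
   bound for every arc; the lower bound is the upper bound for the complementary arc. *)
Require Import Defs.
From mathcomp Require Import all_boot all_order all_algebra finmap.
From mathcomp Require Import all_classical all_reals all_analysis.
From mathcomp Require Import ring lra zify.
Import Order.TTheory GRing.Theory Num.Theory.
Import numFieldNormedType.Exports.
Local Open Scope classical_set_scope.
Local Open Scope ring_scope.

Lemma ord2_cases (i : 'I_2) : i = 0 \/ i = 1.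
Proof. by case: i => [[|[|//]] ?]; [left|right]; apply/val_inj. Qed.

Lemma ord2_other (i j k : 'I_2) : i != j -> k != j -> k = i.
Proof.
by have [->|->] := ord2_cases i; have [->|->] := ord2_cases j; have [->|->] := ord2_cases k.
Qed.

(** * The norm of a lattice vector *)

Section Lattice.
Context {R : realType} (g : 'M[R]_2).
Implicit Types (v w h : 'cV[int]_2).

Definition img v : 'cV[R]_2 := g *m map_mx intr v.

Definition inner v w : R := img v 0 0 * img w 0 0 + img v 1 0 * img w 1 0.

Lemma imgD v w : img (v + w) = img v + img w.
Proof. by rewrite /img map_mxD mulmxDr. Qed.

Lemma imgN v : img (- v) = - img v.
Proof. by rewrite /img map_mxN mulmxN. Qed.

Lemma innerDl v w h : inner (v + w) h = inner v h + inner w h.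
Proof. rewrite /inner imgD !mxE; ring. Qed.

Lemma innerC v w : inner v w = inner w v.
Proof. rewrite /inner; ring. Qed.

Lemma innerNl v w : inner (- v) w = - inner v w.
Proof. rewrite /inner imgN !mxE; ring. Qed.

Lemma innerBl v w h : inner (v - w) h = inner v h - inner w h.
Proof. by rewrite innerDl innerNl. Qed.

Lemma inner_ge0 v : 0 <= inner v v.
Proof. by rewrite /inner -!expr2 addr_ge0 ?sqr_ge0. Qed.

Lemma image_normE v : image_norm g v = Num.sqrt (inner v v).
Proof.
rewrite /image_norm /euclidean_norm big_ord_recl big_ord1 /inner !expr2.
by have -> : lift ord0 ord0 = 1 :> 'I_2 by apply/val_inj.
Qed.

Lemma image_norm_ge0 v : 0 <= image_norm g v.
Proof. by rewrite image_normE sqrtr_ge0. Qed.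

Lemma image_norm_sqr v : image_norm g v ^+ 2 = inner v v.
Proof. by rewrite image_normE sqr_sqrtr // inner_ge0. Qed.

Lemma image_normN v : image_norm g (- v) = image_norm g v.
Proof. by rewrite !image_normE innerNl innerC innerNl opprK. Qed.

Lemma image_norm_inner v w : `|inner v w| <= image_norm g v * image_norm g w.
Proof.
rewrite -ler_sqr ?nnegrE ?normr_ge0 ?mulr_ge0 ?image_norm_ge0 //.
rewrite exprMn !image_norm_sqr real_normK ?num_real // /inner.
set a := img v 0 0; set b := img v 1 0; set c := img w 0 0; set d := img w 1 0.
(* Lagrange's identity: this square is the defect in the Cauchy-Schwarz inequality. *)
have := sqr_ge0 (a * d - b * c); nra.
Qed.

Lemma image_normD_sqr v h :
  image_norm g (v + h) ^+ 2 = image_norm g v ^+ 2 + 2 * inner v h + image_norm g h ^+ 2.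
Proof. rewrite !image_norm_sqr innerDl !(innerC _ (v + h)) !innerDl (innerC h v); ring. Qed.

Lemma image_normD v h : image_norm g (v + h) <= image_norm g v + image_norm g h.
Proof.
rewrite -ler_sqr ?nnegrE ?addr_ge0 ?image_norm_ge0 // image_normD_sqr.
have := image_norm_inner v h; have := ler_norm (inner v h); lra.
Qed.

Lemma image_norm_shift v h : `|image_norm g (v + h) - image_norm g v| <= image_norm g h.
Proof.
have h1 := image_normD v h; have := image_normD (v + h) (- h).
by rewrite addrK image_normN ler_norml; lra.
Qed.

Lemma inner0l v : inner 0 v = 0.
Proof. by have := innerDl 0 0 v; rewrite addr0; lra. Qed.

Lemma image_norm_mulrn v n : image_norm g (v *+ n) = n%:R * image_norm g v.
Proof.
have innM w : inner (v *+ n) w = n%:R * inner v w.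
  by elim: n => [|n IH]; rewrite ?mulr0n ?mul0r ?inner0l // mulrS innerDl IH mulrS; ring.
rewrite !image_normE innM innerC innM mulrA -expr2 sqrtrM ?sqr_ge0 //.
by rewrite sqrtr_sqr ger0_norm // ler0n.
Qed.

Lemma image_normM (p : R) v : 0 <= p -> image_norm (p *: g) v = p * image_norm g v.
Proof.
move=> p0; rewrite /image_norm /euclidean_norm -scalemxAl.
under eq_bigr do rewrite mxE exprMn.
by rewrite -mulr_sumr sqrtrM ?sqr_ge0 // sqrtr_sqr ger0_norm.
Qed.

End Lattice.

(** * Comparison of the norm with the coordinates *)

Section Coordinates.
Context {R : realType} (g : 'M[R]_2).
Hypothesis hg : g \in unitmx.

(** A crude bound for the operator norm of the inverse of [g]; the summand 1 makes it at least 1,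
    hence a safe positive constant. *)
Definition coord_bound : R := 1 + \sum_i \sum_j `|invmx g i j|.

Lemma coord_bound_ge1 : 1 <= coord_bound.
Proof. by rewrite /coord_bound lerDl sumr_ge0 // => i _; rewrite sumr_ge0. Qed.

Lemma coord_le (v : 'cV[int]_2) i : `|v i 0|%:~R <= coord_bound * image_norm g v.
Proof.
have E : map_mx intr v = invmx g *m img g v by rewrite /img mulKmx.
have imgle j : `|img g v j 0| <= image_norm g v.
  rewrite -ler_sqr ?nnegrE ?normr_ge0 ?image_norm_ge0 // image_norm_sqr.
  rewrite real_normK ?num_real // /inner -!expr2.
  have := sqr_ge0 (img g v 0 0); have := sqr_ge0 (img g v 1 0).
  by have [->|->] := ord2_cases j; lra.
have -> : `|v i 0|%:~R = `|(map_mx intr v : 'cV[R]_2) i 0| by rewrite mxE intr_norm.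
rewrite E mxE (le_trans (ler_norm_sum _ _ _)) //.
apply: (@le_trans _ _ (\sum_j `|invmx g i j| * image_norm g v)).
  by apply: ler_sum => j _; rewrite normrM ler_wpM2l.
rewrite -mulr_suml ler_wpM2r ?image_norm_ge0 // /coord_bound.
rewrite [X in _ <= 1 + X](bigD1 i) //=; have : 0 <= \sum_(k | k != i) \sum_j `|invmx g k j|.
  by rewrite sumr_ge0 // => k _; rewrite sumr_ge0.
lra.
Qed.

Definition norm_bound : R := 1 + \sum_i \sum_j `|g i j|.

Lemma norm_bound_ge1 : 1 <= norm_bound.
Proof. by rewrite /norm_bound lerDl sumr_ge0 // => i _; rewrite sumr_ge0. Qed.

Lemma image_norm_le (v : 'cV[int]_2) (M : R) :
  (forall i, `|v i 0|%:~R <= M) -> image_norm g v <= norm_bound * M.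
Proof.
move=> hM; have M0 : 0 <= M by rewrite (le_trans _ (hM 0)) // ler0z.
have le1 i : `|img g v i 0| <= (\sum_j `|g i j|) * M.
  rewrite mxE (le_trans (ler_norm_sum _ _ _)) // mulr_suml ler_sum // => j _.
  by rewrite normrM mxE ler_wpM2l // -intr_norm.
have le2 : image_norm g v <= `|img g v 0 0| + `|img g v 1 0|.
  rewrite -ler_sqr ?nnegrE ?addr_ge0 ?image_norm_ge0 // image_norm_sqr /inner -!expr2.
  rewrite -(real_normK (num_real (img g v 0 0))) -(real_normK (num_real (img g v 1 0))).
  have := mulr_ge0 (normr_ge0 (img g v 0 0)) (normr_ge0 (img g v 1 0)).
  by rewrite !sqrrD; set x := `|_|; set y := `|_|; lra.
have -> : norm_bound = 1 + (\sum_j `|g 0 j| + \sum_j `|g 1 j|).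
  rewrite /norm_bound big_ord_recl big_ord1.
  by have -> : lift ord0 ord0 = 1 :> 'I_2 by apply/val_inj.
apply: (le_trans le2); rewrite !mulrDl mul1r.
by have := le1 0; have := le1 1; lra.
Qed.

End Coordinates.

(** * Counting lattice points in a ball *)

(** Each vector is encoded by its coordinate [j], shifted by [K], and the residue of its coordinate
    [i] modulo [D.+1]. Entries of one row differ by at most [D], so residues separate them without
    an origin being chosen in each row. *)
Lemma card_fset_rows (S : {fset 'cV[int]_2}) (i j : 'I_2) (K D : nat) :
  i != j ->
  (forall v : 'cV[int]_2, v \in S -> `|v j 0| <= K%:Z) ->
  (forall v w : 'cV[int]_2, v \in S -> w \in S -> v j 0 = w j 0 -> `|v i 0 - w i 0| <= D%:Z) ->
  (#|` S| <= (2 * K).+1 * D.+1)%N.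
Proof.
move=> ij hK hD.
pose f (v : 'cV[int]_2) : 'I_(2 * K).+1 * 'I_D.+1 :=
  (inord (absz (v j 0 + K%:Z)), inord (absz ((v i 0)%R %% D.+1%:Z)%Z)).
have finj (v w : 'cV[int]_2) : v \in S -> w \in S -> f v = f w -> v = w.
  move=> vS wS [] /(congr1 val) /= e1 /(congr1 val) /= e2.
  have vK := hK _ vS; have wK := hK _ wS.
  move: e1; rewrite !inordK; [|lia|lia] => e1.
  have e1' : v j 0 = w j 0 by move: e1 vK wK; set x := v j 0; set y := w j 0; lia.
  have m0 (x : int) : (0 <= x %% D.+1%:Z)%Z by rewrite modz_ge0.
  have m1 (x : int) : (x %% D.+1%:Z < D.+1%:Z)%Z by rewrite ltz_pmod.
  have m2 (x : int) : (absz (x %% D.+1%:Z)%Z < D.+1)%N by have := m0 x; have := m1 x; lia.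
  move: e2; rewrite !inordK ?m2 // => e2.
  have e2' : ((v i 0)%R %% D.+1%:Z)%Z = ((w i 0)%R %% D.+1%:Z)%Z.
    by have := m0 (w i 0); have := m0 (v i 0); lia.
  have e3 : v i 0 = w i 0.
    have hvw := hD _ _ vS wS e1'.
    have E1 := divz_eq (v i 0) D.+1%:Z; have E2 := divz_eq (w i 0) D.+1%:Z.
    rewrite e2' in E1; set q1 := ((v i 0)%R %/ _)%Z in E1; set q2 := ((w i 0)%R %/ _)%Z in E2.
    have : v i 0 - w i 0 = (q1 - q2) * D.+1%:Z by rewrite mulrBl; lia.
    by have [->|/eqP q12] := eqVneq q1 q2; nia.
  apply/matrixP => k l; rewrite ord1.
  have [->//|kj] := eqVneq k j.
  by rewrite (ord2_other _ _ _ ij kj).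
have u : uniq (map f S) by rewrite map_inj_in_uniq ?fset_uniq.
by move/card_uniqP: u; rewrite size_map => <-; 
  rewrite (leq_trans (max_card _)) // card_prod !card_ord.
Qed.

Lemma finite_box (K : nat) : finite_set [set v : 'cV[int]_2 | forall i, `|v i 0| <= K%:Z].
Proof.
pose f (x : 'I_(2 * K).+1 * 'I_(2 * K).+1) : 'cV[int]_2 :=
  \col_i ((if i == 0 then x.1 : nat else x.2)%:Z - K%:Z).
apply: (@sub_finite_set _ _ (f @` setT)); last exact/finite_image/finite_finset.
move=> v /= vK; have := vK 0; have := vK 1.
set y : int := v 1 0; set x : int := v 0 0 => yK xK.
exists (inord (absz (x + K%:Z)), inord (absz (y + K%:Z))) => //.
apply/matrixP => i j; rewrite ord1 mxE.
have [->|->] := ord2_cases i.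
  by rewrite /= -/x inordK; lia.
by rewrite /= -/y inordK; lia.
Qed.

Lemma le_truncn_norm {R : realType} (x : int) (y : R) :
  `|x|%:~R <= y -> `|x| <= (Num.truncn y)%:Z.
Proof.
rewrite -natr_absz => xy; rewrite -abszE lez_nat truncn_ge_nat //.
by rewrite (le_trans _ xy) ?ler0n.
Qed.

Section Ball.
Context {R : realType} (g : 'M[R]_2).
Hypothesis hg : g \in unitmx.
Implicit Types (v w h e k : 'cV[int]_2) (r : R).

Lemma ball_coord r v i : image_norm g v <= r -> `|v i 0| <= (Num.truncn (coord_bound g * r))%:Z.
Proof.
move=> vr; apply: le_truncn_norm; apply: (le_trans (coord_le _ hg _ _)).
by rewrite ler_wpM2l // (le_trans ler01) // coord_bound_ge1.
Qed.

Lemma finite_norm_ball r : finite_set [set v | image_norm g v <= r].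
Proof.
apply: sub_finite_set (finite_box (Num.truncn (coord_bound g * r))) => v /= vr i.
exact: ball_coord.
Qed.

Definition norm_ball r : {fset 'cV[int]_2} := fset_set [set v | image_norm g v <= r].

Lemma in_norm_ball r v : (v \in norm_ball r) = (image_norm g v <= r).
Proof. by rewrite in_fset_set; [apply/idP/idP; rewrite inE | exact: finite_norm_ball]. Qed.

Lemma truncn_coord r : 0 <= r -> (Num.truncn (coord_bound g * r))%:R <= coord_bound g * r.
Proof.
by move=> r0; rewrite truncn_le // mulr_ge0 // (le_trans ler01) // coord_bound_ge1.
Qed.

Lemma card_norm_ball r : 0 <= r -> #|` norm_ball r|%:R <= (2 * coord_bound g * r + 1) ^+ 2 :> R.
Proof.
move=> r0; set K := Num.truncn (coord_bound g * r).
have H := card_fset_rows (norm_ball r) 0 1 K (2 * K) isT.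
apply: (@le_trans _ _ ((2 * K).+1 * (2 * K).+1)%:R).
  rewrite ler_nat; apply: H => [v|v w]; rewrite !in_norm_ball => h1; first exact: ball_coord.
  by move=> h2 _; have := ball_coord r v 0 h1; have := ball_coord r w 0 h2; rewrite -/K; lia.
have := truncn_coord r r0; rewrite -/K => h.
have h0 : 0 <= K%:R :> R by rewrite ler0n.
by rewrite natrM -[(2 * K).+1%:R]natr1 natrM; nra.
Qed.


(** Convexity: [v] is the average of [n] copies of [v - e] and one copy of [v + e *+ n]. *)
Lemma ball_boundary_chord r v e n : image_norm g (v - e) <= r ->
  image_norm g (v + e *+ n) <= r -> image_norm g v <= r.
Proof.
move=> h1 h2; suff : n.+1%:R * image_norm g v <= n.+1%:R * r by rewrite ler_pM2l ?ltr0n.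
have E : v *+ n.+1 = (v - e) *+ n + (v + e *+ n) by rewrite mulrnBl mulrSr addrACA addNr addr0.
rewrite -image_norm_mulrn E (le_trans (image_normD _ _ _)) // image_norm_mulrn -natr1.
by have := @ler0n R n; nra.
Qed.

(* By convexity of the ball, each line parallel to [e] meets this boundary layer at most once. *)
Lemma card_ball_boundary r e (i j : 'I_2) (S : {fset 'cV[int]_2}) : i != j -> 0 <= r ->
  e j 0 = 0 -> `|e i 0| = 1 ->
  (forall v : 'cV[int]_2, v \in S ->
     image_norm g (v - e) <= r /\ ~~ (image_norm g v <= r)) ->
  #|` S|%:R <= 2 * coord_bound g * (r + image_norm g e) + 1.
Proof.
move=> ij r0 ej ei hS.
have re0 : 0 <= r + image_norm g e by rewrite addr_ge0 // image_norm_ge0.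
set K := Num.truncn (coord_bound g * (r + image_norm g e)).
have hc := truncn_coord _ re0; rewrite -/K in hc.
suff : (#|` S| <= (2 * K).+1 * 1)%N.
  by rewrite muln1 -(ler_nat R) -[(2 * K).+1%:R]natr1 natrM; lra.
apply: (card_fset_rows S i j K 0 ij) => [v /hS [v1 _]|].
  apply: ball_coord; rewrite -[v](subrK e) (le_trans (image_normD _ _ _)) //.
  by rewrite lerD2r.
(* Otherwise [v] would lie on the chord from [v - e] to [w - e], whose ends are in the ball,
   although [v] is outside. *)
have key (v w : 'cV[int]_2) n : v \in S -> w \in S -> w - v <> e *+ n.+1.
  move=> /hS[v1 /negP v2] /hS[w1 _] E; apply: v2.
  apply: (ball_boundary_chord r v e n v1).
  by have -> : v + e *+ n = w - e by rewrite -[w](subrK v) E mulrSr addrAC addrK addrC.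
move=> v w vS wS vwj; suff -> : v i 0 = w i 0 by rewrite subrr.
set x : int := v i 0; set y : int := w i 0.
have diff (a b : 'cV[int]_2) n : a j 0 = b j 0 -> b i 0 - a i 0 = e i 0 *+ n -> b - a = e *+ n.
  move=> abj abi; apply/matrixP => k l; rewrite ord1 mulmxnE !mxE.
  have [->|kj] := eqVneq k j; first by rewrite abj ej subrr mul0rn.
  by rewrite (ord2_other _ _ _ ij kj).
have [//|xy] := eqVneq x y; exfalso.
set u : int := e i 0; rewrite -/u in ei; have u1 : u = 1 \/ u = -1 by lia.
have [h|h] := boolP (0 < (y - x) * u).
  apply: (key v w (absz (y - x)).-1 vS wS); apply: diff => //; rewrite -/x -/y -/u.
  by rewrite -mulr_natr natz; case: u1 => uE; rewrite uE in h *; lia.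
apply: (key w v (absz (y - x)).-1 wS vS); apply: diff => //; rewrite -/x -/y -/u.
by rewrite -mulr_natr natz; case: u1 => uE; rewrite uE in h *; lia.
Qed.

Lemma ler_norm_sum_fset (T : choiceType) (S : {fset T}) (X : T -> R) (M : R) :
  (forall x, `|X x| <= M) -> `|\sum_(x <- S) X x| <= M * #|` S|%:R.
Proof.
move=> hM; rewrite (le_trans (ler_norm_sum _ _ _)) //.
rewrite (le_trans (ler_sum _ (fun x _ => hM x))) // big_const_seq count_predT.
by rewrite iter_addr_0 mulr_natr.
Qed.

(** The constant is uniform over all [X] with the same bound [M]. Hence the estimate applies to
    translates of [X], and the property passes to sums and opposites of steps. *)
Definition shift_bounded h := exists C : R, forall (X : 'cV[int]_2 -> R) (M r : R),
  (forall v, `|X v| <= M) -> 0 <= r ->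
  `|\sum_(v <- norm_ball r) (X (v + h) - X v)| <= C * M * (r + 1).

Lemma shift_boundedD h k : shift_bounded h -> shift_bounded k -> shift_bounded (h + k).
Proof.
move=> [C hC] [D hD]; exists (C + D) => X M r hM r0.
have h1 := hC (fun v => X (v + k)) M r (fun v => hM _) r0.
have h2 := hD X M r hM r0.
under eq_bigr => v _ do
  rewrite addrA -[X (v + h + k) - X v](subrKA (X (v + k))).
rewrite big_split /= (le_trans (ler_normD _ _)) //; lra.
Qed.

Lemma shift_boundedN h : shift_bounded h -> shift_bounded (- h).
Proof.
move=> [C hC]; exists C => X M r hM r0.
have := hC (fun v => X (v - h)) M r (fun v => hM _) r0.
rewrite -normrN -sumrN; congr (`|_| <= _).
by apply: eq_bigr => v _; rewrite addrK opprB.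
Qed.

Lemma shift_bounded_unit (e : 'cV[int]_2) (i j : 'I_2) : i != j ->
  e j 0 = 0 -> `|e i 0| = 1 -> shift_bounded e.
Proof.
move=> ij ej ei.
exists (2 * (2 * coord_bound g * (1 + image_norm g e) + 1)) => X M r hM r0.
pose B := norm_ball r; pose B' := [fset (v + e)%R | v in B]%fset.
have c1 := coord_bound_ge1 g; have n0 := image_norm_ge0 g e.
have M0 : 0 <= M by rewrite (le_trans _ (hM 0)).
have inB' v : (v \in B') = (image_norm g (v - e) <= r).
  rewrite -in_norm_ball; apply/imfsetP/idP => [[w wB ->]|vB]; first by rewrite addrK.
  by exists (v - e); rewrite ?subrK.
rewrite sumrB.
have -> : \sum_(v <- norm_ball r) X (v + e) = \sum_(v <- B') X v.
  by rewrite big_imfset //= => v w _ _ /addIr.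
(* The common part of the ball and its translate cancels; two boundary layers remain. *)
rewrite (big_fsetID _ (mem B) B') (big_fsetID _ (mem B') B) /=.
have -> : [fset x in B' | x \in B]%fset = [fset x in B | x \in B']%fset.
  by apply/fsetP => x; rewrite !inE /= andbC.
rewrite opprD addrACA subrr add0r (le_trans (ler_normB _ _)) //.
have b1 : `|\sum_(v <- [fset x in B' | x \notin B]%fset) X v| <=
    M * (2 * coord_bound g * (r + image_norm g e) + 1).
  apply: (le_trans (ler_norm_sum_fset _ _ _ M hM)); rewrite ler_wpM2l //.
  apply: (card_ball_boundary r e i j) => // v.
  by rewrite !inE /= -/B -inB' -in_norm_ball => /andP[].
have b2 : `|\sum_(v <- [fset x in B | x \notin B']%fset) X v| <=
    M * (2 * coord_bound g * (r + image_norm g e) + 1).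
  (* Moved back by [e], the second layer becomes a boundary layer for the step [- e]. *)
  pose B2 := [fset (v - e)%R | v in [fset x in B | x \notin B']]%fset.
  have -> : \sum_(v <- [fset x in B | x \notin B']%fset) X v = \sum_(v <- B2) X (v + e).
    rewrite [RHS]big_imfset /=; last by move=> v w _ _; exact: addIr.
    by apply: eq_bigr => v _; rewrite subrK.
  apply: (le_trans (ler_norm_sum_fset _ _ _ M (fun v => hM _))); rewrite ler_wpM2l //.
  rewrite -[image_norm g e]image_normN.
  apply: (card_ball_boundary r (- e) i j); rewrite ?mxE ?ej ?oppr0 ?normrN // => v.
  move=> /imfsetP[w /=]; rewrite !inE /= inB' in_norm_ball => /andP[w1 w2] ->.
  by rewrite opprK subrK.
apply: (le_trans (lerD b1 b2)).
set C := coord_bound g in c1 *; set n := image_norm g e in n0 *.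
have C0 : 0 <= C by rewrite (le_trans ler01).
have : 0 <= M * (2 * C * n * r + 2 * C + r) by rewrite mulr_ge0 ?addr_ge0 ?mulr_ge0.
lra.
Qed.

Lemma shift_bounded_all h : shift_bounded h.
Proof.
have nat_case (e : 'cV[int]_2) (n : nat) : shift_bounded e -> shift_bounded (e *+ n).
  move=> he; elim: n => [|n IH]; last by rewrite mulrS; exact: shift_boundedD.
  by rewrite mulr0n; have := shift_boundedD _ _ he (shift_boundedN _ he); rewrite subrr.
have int_case (e : 'cV[int]_2) (n : int) : shift_bounded e -> shift_bounded (e *~ n).
  by case: n => n he; [exact: nat_case|rewrite NegzE mulrNz; apply/shift_boundedN/nat_case].
have unit_case (i j : 'I_2) : i != j -> shift_bounded (delta_mx i 0).
  move=> ij; apply: (shift_bounded_unit _ i j ij); rewrite mxE !eqxx //=.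
  by rewrite eq_sym (negbTE ij).
have -> : h = delta_mx 0 0 *~ h 0 0 + delta_mx 1 0 *~ h 1 0.
  apply/matrixP => i j; rewrite ord1 !mxE -!scaler_int !mxE.
  have [->|->] := ord2_cases i.
    by rewrite /= !intz mulr1 mulr0 addr0.
  by rewrite /= !intz mulr1 mulr0 add0r.
by apply: shift_boundedD; apply: int_case; [apply: (unit_case 0 1)|apply: (unit_case 1 0)].
Qed.

End Ball.

(** * Functions of mean zero and slowly oscillating functions *)

Lemma sum_indicator {R : realType} (T : choiceType) (S : {fset T}) (P : pred T) :
  \sum_(x <- S) (P x)%:R = #|` [fset x in S | P x]%fset|%:R :> R.
Proof.
rewrite card_fset_sum1 natr_sum big_fset /= [RHS]big_mkcond /=.
by apply: eq_bigr => x _; case: (P x).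
Qed.

Lemma le_affine_sqr {R : realType} (A B e : R) : 0 < e ->
  \forall r \near +oo, A * r + B <= e * r ^+ 2.
Proof.
move=> e0; near=> r.
have r1 : 1 <= r by near: r; apply: nbhs_pinfty_ge; rewrite num_real.
have h : (`|A| + `|B|) / e <= r by near: r; apply: nbhs_pinfty_ge; rewrite num_real.
rewrite ler_pdivrMr // in h.
have := ler_norm A; have := ler_norm B; have := normr_ge0 B; have := normr_ge0 A.
nra.
Unshelve. all: by end_near. Qed.

Section Asymptotics.
Context {R : realType} (g : 'M[R]_2).
Hypothesis hg : g \in unitmx.
Implicit Types (v w h k : 'cV[int]_2) (r : R) (X Y F : 'cV[int]_2 -> R).

(** Mean value zero over large balls, as a ball of radius [r] holds on the order of [r ^+ 2] lattice
    vectors. *)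
Definition density_null X := forall e : R, 0 < e ->
  \forall r \near +oo, `|\sum_(v <- norm_ball g r) X v| <= e * r ^+ 2.

Definition vanishing X := forall e : R, 0 < e ->
  exists rho : R, forall v, rho <= image_norm g v -> `|X v| <= e.

Definition fun_bounded X := exists M : R, forall v, `|X v| <= M.

(** The admissible weights: vanishing differences allow a shift of the argument at negligible cost,
    and boundedness makes the class closed under products. *)
Definition slowly_oscillating X :=
  fun_bounded X /\ forall h, vanishing (fun v => X (v + h) - X v).

Lemma card_norm_ball_sqr r : 1 <= r ->
  #|` norm_ball g r|%:R <= (2 * coord_bound g + 1) ^+ 2 * r ^+ 2.
Proof.
move=> r1; have r0 : 0 <= r by rewrite (le_trans ler01).
have c1 := coord_bound_ge1 g.
apply: (le_trans (card_norm_ball _ hg _ r0)); rewrite -exprMn ler_sqr ?nnegrE; nra.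
Qed.

Lemma sum_norm_ball_le X Y r : (forall v, image_norm g v <= r -> X v <= Y v) ->
  \sum_(v <- norm_ball g r) X v <= \sum_(v <- norm_ball g r) Y v.
Proof.
by move=> XY; rewrite big_seq [leRHS]big_seq ler_sum // => v; rewrite in_norm_ball //; exact: XY.
Qed.

(** The bound does not depend on [r], so the vectors of norm below a fixed [rho] are negligible
    against [r ^+ 2]. *)
Lemma sum_norm_ball_cut X (rho r : R) : (forall v, 0 <= X v) ->
  \sum_(v <- norm_ball g r) ((image_norm g v < rho)%R%:R * X v) <= \sum_(v <- norm_ball g rho) X v.
Proof.
move=> X0; under eq_bigr do rewrite mulr_natl mulrb.
rewrite -big_mkcond /= big_fset_condE [leRHS](big_fsetID _ (fun v => (image_norm g v < rho)%R)) /=.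
rewrite ler_wpDr ?sumr_ge0 // [leRHS](big_fsetID _ (mem (norm_ball g r))) /=.
rewrite ler_wpDr ?sumr_ge0 // le_eqVlt; apply/orP; left; apply/eqP.
apply: eq_fbigl => v; rewrite !inE /= !in_norm_ball //.
by case: ltP => [/ltW ->|]; rewrite /= ?andbT ?andbF.
Qed.

Lemma density_nullD X Y : density_null X -> density_null Y -> density_null (fun v => X v + Y v).
Proof.
move=> hX hY e e0; have e2 : 0 < e / 2 by lra.
near=> r; rewrite big_split /= (le_trans (ler_normD _ _)) //.
have -> : e * r ^+ 2 = e / 2 * r ^+ 2 + e / 2 * r ^+ 2 by field.
by apply: lerD; near: r; [exact: hX|exact: hY].
Unshelve. all: by end_near. Qed.

Lemma density_nullN X : density_null X -> density_null (fun v => - X v).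
Proof.
by move=> hX e e0; near=> r; rewrite sumrN normrN; near: r; exact: hX.
Unshelve. all: by end_near. Qed.

Lemma density_null_eq X Y : X =1 Y -> density_null X -> density_null Y.
Proof. by move=> /funext ->. Qed.

Lemma density_null_sum (I : Type) (s : seq I) (X : I -> 'cV[int]_2 -> R) :
  (forall i, density_null (X i)) -> density_null (fun v => \sum_(i <- s) X i v).
Proof.
move=> hX; elim: s => [|i s IH].
  move=> e e0; near=> r; rewrite big1 ?normr0 ?mulr_ge0 ?sqr_ge0 ?(ltW e0) // => v _.
  by rewrite big_nil.
by apply: density_null_eq (density_nullD _ _ (hX i) IH) => v; rewrite big_cons.
Unshelve. all: by end_near. Qed.

Lemma vanishing_density_null X : vanishing X -> density_null X.
Proof.
move=> hX e e0.
have c1 := coord_bound_ge1 g; set A := (2 * coord_bound g + 1) ^+ 2.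
have A0 : 0 < A by rewrite exprn_gt0 //; lra.
(* A far vector contributes at most [e / 2 / A], and the ball holds at most [A * r ^+ 2] vectors;
   the near ones contribute a constant. *)
have [rho hrho] := hX (e / 2 / A) (divr_gt0 (divr_gt0 e0 (ltr0Sn _ 1)) A0).
set S := \sum_(v <- norm_ball g rho) `|X v|.
near=> r; rewrite (le_trans (ler_norm_sum _ _ _)) //.
apply: (@le_trans _ _ (\sum_(v <- norm_ball g r)
    (e / 2 / A + (image_norm g v < rho)%R%:R * `|X v|))).
  apply: ler_sum => v _; have [vr|vr] := ltP (image_norm g v) rho.
    by rewrite mul1r lerDr !divr_ge0 // ltW.
  by rewrite mul0r addr0 hrho.
rewrite big_split /= big_const_seq count_predT iter_addr_0 -[_ *+ size _]mulr_natr.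
have -> : e * r ^+ 2 = e / 2 / A * (A * r ^+ 2) + e / 2 * r ^+ 2 by field; rewrite gt_eqF.
apply: lerD.
  by rewrite ler_wpM2l ?divr_ge0 ?(ltW e0) ?(ltW A0) ?card_norm_ball_sqr //.
apply: (le_trans (sum_norm_ball_cut _ _ _ (fun v => normr_ge0 _))).
suff : 0 * r + S <= e / 2 * r ^+ 2 by rewrite mul0r add0r.
by near: r; apply: le_affine_sqr; rewrite divr_gt0.
Unshelve. all: by end_near. Qed.

Lemma shift_density_null X h : fun_bounded X -> density_null (fun v => X (v + h) - X v).
Proof.
move=> [M hM] e e0; have [C hC] := shift_bounded_all _ hg h.
near=> r; apply: (le_trans (hC X M r hM _)).
  by near: r; apply: nbhs_pinfty_ge; rewrite num_real.
rewrite mulrDr mulr1; near: r; exact: le_affine_sqr.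
Unshelve. all: by end_near. Qed.

Lemma boundedM X Y : fun_bounded X -> fun_bounded Y -> fun_bounded (fun v => X v * Y v).
Proof.
by move=> [M hM] [N hN]; exists (M * N) => v; rewrite normrM ler_pM.
Qed.

Lemma vanishing_le X Y (K : R) : (forall v, `|X v| <= K * `|Y v|) -> vanishing Y -> vanishing X.
Proof.
move=> XY hY e e0; have K0 : 0 < `|K| + 1 by rewrite ltr_wpDl.
have [rho hrho] := hY (e / (`|K| + 1)) (divr_gt0 e0 K0); exists rho => v /hrho h.
apply: (le_trans (XY v)).
rewrite ler_pdivlMr // in h; have := ler_norm K; have := normr_ge0 (Y v); nra.
Qed.

Lemma vanishingD X Y : vanishing X -> vanishing Y -> vanishing (fun v => X v + Y v).
Proof.
move=> hX hY e e0; have e2 : 0 < e / 2 by lra.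
have [r1 h1] := hX _ e2; have [r2 h2] := hY _ e2; exists (Num.max r1 r2) => v.
rewrite ge_max => /andP[/h1 a1 /h2 a2]; rewrite (le_trans (ler_normD _ _)) //; lra.
Qed.

(** Summation by parts: the difference of the product [X * F] telescopes up to the boundary, and the
    correction [(X (v + h) - X v) * F (v + h)] tends to zero. *)
Lemma slow_shift_density_null X F h : slowly_oscillating X -> fun_bounded F ->
  density_null (fun v => X v * (F (v + h) - F v)).
Proof.
move=> [bX oX] bF.
have h1 := shift_density_null _ h (boundedM _ _ bX bF).
have h2 : density_null (fun v => (X (v + h) - X v) * F (v + h)).
  apply: vanishing_density_null; have [M hM] := bF.
  apply: (vanishing_le _ _ M _ (oX h)) => v.
  by rewrite normrM mulrC ler_wpM2r.
by apply: density_null_eq (density_nullD _ _ h1 (density_nullN _ h2)) => v; ring.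
Qed.

Lemma slowM X Y : slowly_oscillating X -> slowly_oscillating Y ->
  slowly_oscillating (fun v => X v * Y v).
Proof.
move=> [bX oX] [bY oY]; split; first exact: boundedM.
move=> h; have [M hM] := bX; have [N hN] := bY.
have h1 : vanishing (fun v => X (v + h) * (Y (v + h) - Y v)).
  by apply: (vanishing_le _ _ M _ (oY h)) => v; rewrite normrM ler_wpM2r.
have h2 : vanishing (fun v => Y v * (X (v + h) - X v)).
  by apply: (vanishing_le _ _ N _ (oX h)) => v; rewrite normrM ler_wpM2r.
apply: (vanishing_le _ _ 1 _ (vanishingD _ _ h1 h2)) => v.
by rewrite mul1r le_eqVlt; apply/orP; left; apply/eqP; congr `|_|; ring.
Qed.

Lemma slowD X Y : slowly_oscillating X -> slowly_oscillating Y ->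
  slowly_oscillating (fun v => X v + Y v).
Proof.
move=> [[M hM] oX] [[N hN] oY]; split.
  by exists (M + N) => v; rewrite (le_trans (ler_normD _ _)) ?lerD.
move=> h; apply: (vanishing_le _ _ 1 _ (vanishingD _ _ (oX h) (oY h))) => v.
by rewrite mul1r le_eqVlt; apply/orP; left; apply/eqP; congr `|_|; ring.
Qed.

Lemma slow_comp X (f : R -> R) (L : R) : (forall x y, `|f x - f y| <= L * `|x - y|) ->
  slowly_oscillating X -> slowly_oscillating (fun v => f (X v)).
Proof.
move=> fL [[M hM] oX]; split; last by move=> h; apply: vanishing_le (oX h).
exists (`|f 0| + `|L| * M) => v; rewrite -[f (X v)](subrK (f 0)) addrC.
rewrite (le_trans (ler_normD _ _)) // lerD2l (le_trans (fL _ _)) // subr0.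
by rewrite (le_trans (ler_wpM2r _ (ler_norm L))) // ler_wpM2l.
Qed.

Lemma slow_sum (I : Type) (s : seq I) (X : I -> 'cV[int]_2 -> R) :
  (forall i, slowly_oscillating (X i)) -> slowly_oscillating (fun v => \sum_(i <- s) X i v).
Proof.
move=> hX; elim: s => [|i s IH].
  under [X in slowly_oscillating X]funext => v do rewrite big_nil.
  split; first by exists 0 => v; rewrite normr0.
  by move=> h e e0; exists 0 => v _; rewrite subr0 normr0 ltW.
have := slowD _ _ (hX i) IH; congr slowly_oscillating.
by apply/funext => v; rewrite big_cons.
Qed.

End Asymptotics.

(** * Increments of the norm *)

Section Increments.
Context {R : realType} (g : 'M[R]_2).
Hypothesis hg : g \in unitmx.
Implicit Types (v w h k : 'cV[int]_2) (r : R).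

Definition incr h v : R := image_norm g (v + h) - image_norm g v.

Lemma incr_le h v : `|incr h v| <= image_norm g h.
Proof. exact: image_norm_shift. Qed.

(** By the difference of squares, the increment times the sum of the two norms is
    [2 * inner g h v + image_norm g h ^+ 2]. Replacing that sum by twice the norm of [v] costs a
    term of order [1 / image_norm g v]. *)
Lemma incr_approx h v : 0 < image_norm g v ->
  `|incr h v - inner g h v / image_norm g v| <= 2 * image_norm g h ^+ 2 / image_norm g v.
Proof.
move=> v0; have := image_normD_sqr g v h; rewrite (innerC g v h).
have := image_norm_inner g h v; have := incr_le h v; rewrite /incr.
have := image_norm_ge0 g h; have := image_norm_ge0 g (v + h).
set a := image_norm g v in v0 *; set b := image_norm g (v + h); set c := image_norm g h.
set s := inner g h v => b0 c0 hi hs hD.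
have E : (b - a - s / a) = (c ^+ 2 * a - s * (b - a)) / (a * (b + a)).
  have -> : c ^+ 2 = b ^+ 2 - a ^+ 2 - 2 * s by rewrite hD; ring.
  by field; rewrite ?gt_eqF ?ltr_wpDl.
have ab : 0 < a * (b + a) by rewrite mulr_gt0 // ltr_wpDl.
rewrite E normrM normfV (gtr0_norm ab) ler_pdivrMr //.
have -> : 2 * c ^+ 2 / a * (a * (b + a)) = 2 * c ^+ 2 * (b + a) by field; rewrite gt_eqF.
have h1 : `|s * (b - a)| <= c ^+ 2 * a.
  rewrite normrM (_ : c ^+ 2 * a = (c * a) * c); last by ring.
  exact: ler_pM.
have h2 : 0 <= c ^+ 2 * b by rewrite mulr_ge0 ?sqr_ge0.
have h3 : 0 <= c ^+ 2 * a by rewrite mulr_ge0 ?sqr_ge0 // ltW.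
by apply: (le_trans (ler_normB _ _)); rewrite (ger0_norm h3); lra.
Qed.

Lemma inner_direction_vanishing h k :
  vanishing g (fun v => inner g h (v + k) / image_norm g (v + k) - inner g h v / image_norm g v).
Proof.
move=> e e0; have := image_norm_ge0 g h; have := image_norm_ge0 g k.
set c := image_norm g h; set d := image_norm g k => d0 c0.
(* The difference is at most [2 * c * d / b]. The summand [d] pays for the shift, so that [b]
   exceeds [2 * c * d / e]; the 1 keeps both norms positive. *)
exists (d + 1 + 2 * c * d / e) => v.
have := image_norm_shift g v k; have := image_norm_inner g h v; have := image_norm_inner g h k.
rewrite -/c -/d; set a := image_norm g v; set b := image_norm g (v + k) => hk hv hb ha.
have q0 : 0 <= 2 * c * d / e by rewrite divr_ge0 ?mulr_ge0 // ltW.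
have b1 : 2 * c * d / e + 1 <= b by move: hb; rewrite ler_norml; lra.
have a0 : 0 < a by lra.
have b0 : 0 < b by lra.
have -> : inner g h (v + k) / b - inner g h v / a =
    (inner g h k * a + inner g h v * (a - b)) / (a * b).
  by rewrite innerC innerDl !(innerC g _ h); field; rewrite ?gt_eqF.
have ab : 0 < a * b by rewrite mulr_gt0.
rewrite normrM normfV (gtr0_norm ab) ler_pdivrMr //.
have h1 : `|inner g h k * a| <= c * d * a by rewrite normrM (gtr0_norm a0) ler_wpM2r // ltW.
have h2 : `|inner g h v * (a - b)| <= c * a * d by rewrite normrM ler_pM // distrC.
have h3 : 2 * c * d <= e * b.
  have E : 2 * c * d = e * (2 * c * d / e) by field; rewrite gt_eqF.
  by rewrite E ler_pM2l //; lra.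
rewrite (le_trans (ler_normD _ _)) //.
have : 2 * c * d * a <= e * b * a by rewrite ler_pM2r.
lra.
Qed.

Lemma inv_norm_vanishing (C : R) : vanishing g (fun v => C / image_norm g v).
Proof.
move=> e e0; exists (`|C| / e + 1) => v hv.
have q0 : 0 <= `|C| / e by rewrite divr_ge0 // ltW.
have v0 : 0 < image_norm g v by lra.
rewrite normrM normfV (gtr0_norm v0) ler_pdivrMr // mulrC -ler_pdivrMr //; lra.
Qed.

(** The main term of the increment depends only on the direction of [v], which a fixed step hardly
    changes far out; the error term vanishes at infinity. *)
Lemma incr_slow h : slowly_oscillating g (incr h).
Proof.
split; first by exists (image_norm g h) => v; exact: incr_le.
move=> k.
have far (X : 'cV[int]_2 -> R) : vanishing g X -> vanishing g (fun v => X (v + k)).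
  move=> hX e /hX[rho hrho]; exists (rho + image_norm g k) => v hv; apply: hrho.
  by have := image_norm_shift g v k; rewrite ler_norml; lra.
pose D v := incr h v - inner g h v / image_norm g v.
have hD : vanishing g D.
  move=> e e0; have [rho hrho] := inv_norm_vanishing (2 * image_norm g h ^+ 2) e e0.
  exists (Num.max 1 rho) => v; rewrite ge_max => /andP[v1 /hrho hv].
  have v0 : 0 < image_norm g v by lra.
  by rewrite (le_trans (incr_approx h v v0)) // (le_trans (ler_norm _)).
have hN : vanishing g (fun v => - D v).
  by move=> e /hD[rho hr]; exists rho => v; rewrite normrN; exact: hr.
have := vanishingD _ _ _ (vanishingD _ _ _ (far _ hD) hN) (inner_direction_vanishing h k).
by congr vanishing; apply/funext => v; rewrite /D; ring.
Qed.

Lemma inner_linear h : exists al : 'I_2 -> R,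
  forall v, inner g h v = al 0 * (v 0 0)%:~R + al 1 * (v 1 0)%:~R.
Proof.
exists (fun i => img g h 0 0 * g 0 i + img g h 1 0 * g 1 i) => v.
have E i : img g v i 0 = g i 0 * (v 0 0)%:~R + g i 1 * (v 1 0)%:~R.
  rewrite mxE big_ord_recl big_ord1 !mxE.
  by have -> : lift ord0 ord0 = 1 :> 'I_2 by apply/val_inj.
by rewrite /inner !E; ring.
Qed.

Lemma image_norm_eq0 h : image_norm g h = 0 -> h = 0.
Proof.
move=> h0; apply/matrixP => i j; rewrite ord1 mxE.
have := coord_le g hg h i; rewrite h0 mulr0 (_ : 0 = 0%:~R) // ler_int => hi.
by apply/eqP; rewrite -normr_le0.
Qed.

(** With the coordinate [j] fixed, [inner g h v] is affine in the coordinate [i] with nonzero slope,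
    so the strip meets each row in an interval of length [2 * d * r / A]. There are [O(r)] rows,
    hence [O(d * r ^+ 2 + r)] points. *)
Lemma strip_count h (e : R) : h != 0 -> 0 < e -> exists2 d0 : R, 0 < d0 &
  forall d : R, 0 < d <= d0 -> \forall r \near +oo,
    \sum_(v <- norm_ball g r) (`|inner g h v| <= d * r)%R%:R <= e * r ^+ 2.
Proof.
move=> hn0 e0; have [al hal] := inner_linear h.
have [i ali] : exists i, al i != 0.
  apply/not_existsP => al0; move/eqP: hn0; apply; apply: image_norm_eq0.
  have z i : al i = 0 by apply/eqP; have := al0 i; move/negP; rewrite negbK.
  by rewrite image_normE hal !z !mul0r addr0 sqrtr0.
have [j ij halj] : exists2 j : 'I_2, i != j &
    forall v, inner g h v = al i * (v i 0)%:~R + al j * (v j 0)%:~R.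
  have [iE|iE] := ord2_cases i.
    by exists 1; rewrite iE.
  by exists 0; rewrite iE // => v; rewrite hal addrC.
set A := `|al i|; have A0 : 0 < A by rewrite normr_gt0.
have c1 := coord_bound_ge1 g; set C := coord_bound g in c1 *.
have C0 : 0 < 2 * C + 1 by lra.
(* This makes the coefficient of [r ^+ 2] at most [e / 2]; the other half absorbs the linear
   term. *)
exists (e * A / (4 * (2 * C + 1))); first by rewrite divr_gt0 ?mulr_gt0.
move=> d /andP[d0 dle]; rewrite ler_pdivlMr ?mulr_gt0 // in dle.
near=> r.
have r1 : 1 <= r by near: r; apply: nbhs_pinfty_ge; rewrite num_real.
have r0 : 0 <= r by lra.
rewrite sum_indicator.
set S := [fset _ | _ in _ & _]%fset.
set K := Num.truncn (C * r); set D := Num.truncn (2 * d * r / A).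
have hD : D%:R <= 2 * d * r / A by rewrite truncn_le divr_ge0 ?mulr_ge0 ?ltW.
have hK : K%:R <= C * r by exact: truncn_coord.
have : (#|` S| <= (2 * K).+1 * D.+1)%N.
  apply: (card_fset_rows S i j) => // [v|v w]; rewrite !inE /= !in_norm_ball //.
    by move=> /andP[vr _]; exact: ball_coord.
  move=> /andP[_ v1] /andP[_ w1] vw; apply: le_truncn_norm.
  rewrite ler_pdivlMr // intr_norm rmorphB /= mulrC /A -normrM mulrBr.
  have -> : al i * (v i 0)%:~R - al i * (w i 0)%:~R = inner g h v - inner g h w.
    by rewrite !halj vw; ring.
  by rewrite (le_trans (ler_normB _ _)) //; lra.
rewrite -(ler_nat R) natrM -[(2 * K).+1%:R]natr1 -[D.+1%:R]natr1 natrM => hS.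
apply: (le_trans hS).
have K0 := ler0n R K; have D0 := ler0n R D.
apply: (@le_trans _ _ ((2 * C + 1) * r * (2 * d * r / A + 1))).
  by apply: ler_pM; rewrite ?addr_ge0 ?mulr_ge0 //; nra.
have -> : (2 * C + 1) * r * (2 * d * r / A + 1) =
    (2 * C + 1) * r + 2 * d * (2 * C + 1) / A * r ^+ 2 by field; rewrite gt_eqF.
have h1 : 2 * d * (2 * C + 1) / A <= e / 2.
  by rewrite ler_pdivrMr //; lra.
have h2 : (2 * C + 1) * r + 0 <= e / 2 * r ^+ 2.
  by near: r; apply: le_affine_sqr; rewrite divr_gt0.
have h3 : 2 * d * (2 * C + 1) / A * r ^+ 2 <= e / 2 * r ^+ 2 by rewrite ler_wpM2r ?sqr_ge0.
lra.
Unshelve. all: by end_near. Qed.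

Lemma strips_count (H : seq 'cV[int]_2) (e : R) : 0 \notin H -> 0 < e -> exists2 d0 : R, 0 < d0 &
  forall d : R, 0 < d <= d0 -> \forall r \near +oo,
    \sum_(v <- norm_ball g r) \sum_(h <- H) (`|inner g h v| <= d * r)%R%:R <= e * r ^+ 2.
Proof.
elim: H e => [|h H IH] e.
  move=> _ e0; exists 1 => // d _; near=> r.
  by rewrite big1 ?mulr_ge0 ?sqr_ge0 ?ltW // => v _; rewrite big_nil.
rewrite inE negb_or eq_sym => /andP[h0 hH] e0; have e2 : 0 < e / 2 by lra.
have [d1 d10 h1] := IH _ hH e2; have [d2 d20 h2] := strip_count _ _ h0 e2.
exists (Num.min d1 d2); first by rewrite lt_min d10.
move=> d /andP[d0]; rewrite le_min => /andP[dd1 dd2].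
near=> r; under eq_bigr do rewrite big_cons.
rewrite big_split /= (_ : e * r ^+ 2 = e / 2 * r ^+ 2 + e / 2 * r ^+ 2); last by field.
by apply: lerD; near: r; [apply: h2|apply: h1]; rewrite d0.
Unshelve. all: by end_near. Qed.

End Increments.

(** * Equidistribution over all lattice vectors *)

(** A half-open arc of the circle given by start and length. It may wrap past an integer, so
    complements of arcs are again arcs. *)
Definition in_arc {R : realType} (a l x : R) : bool := frac_part (x - a) < l.

(* The primitive of [1_[0,c) - c], periodic of period 1. *)
Definition sawtooth {R : realType} (c x : R) : R := Num.min (frac_part x) c - c * frac_part x.

Section Arc.
Context {R : realType}.
Implicit Types (a l c x y : R).

Lemma frac_part_itv x : 0 <= frac_part x < 1.
Proof.
by have := floor_itv x; rewrite intrD /frac_part; lra.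
Qed.

Lemma frac_part_unique x (n : int) : 0 <= x - n%:~R < 1 -> frac_part x = x - n%:~R.
Proof.
move=> h; rewrite /frac_part; suff -> : Num.floor x = n by [].
by apply: floor_def; rewrite intrD; lra.
Qed.

Lemma frac_partD x y : 0 <= y < 1 ->
  (frac_part x + y < 1 /\ frac_part (x + y) = frac_part x + y) \/
  (1 <= frac_part x + y /\ frac_part (x + y) = frac_part x + y - 1).
Proof.
move=> hy; have hx := frac_part_itv x.
have [h|h] := ltP (frac_part x + y) 1; [left|right]; split=> //.
  rewrite (frac_part_unique _ (Num.floor x)) /frac_part; first by ring.
  by rewrite /frac_part in hx h; lra.
rewrite (frac_part_unique _ (Num.floor x + 1)) /frac_part intrD; first by ring.
by rewrite mulr1z; rewrite /frac_part in hx h; lra.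
Qed.

Lemma in_arcC a l x : 0 <= l <= 1 -> in_arc (a + l) (1 - l) x = ~~ in_arc a l x.
Proof.
move=> hl; rewrite /in_arc -leNgt.
have h1 := frac_part_itv (x - a); have h2 := frac_part_itv (x - (a + l)).
(* [frac_partD] requires [l < 1]; for [l = 1] both sides are false. *)
have [l1|l1] := ltP l 1; last first.
  have lE : l = 1 by lra.
  by rewrite lE subrr in h2 *; apply/idP/idP; lra.
have [|[E1 E2]|[E1 E2]] := frac_partD (x - (a + l)) l; first by lra.
  have E : x - (a + l) + l = x - a by ring.
  by rewrite E in E2; apply/idP/idP; lra.
have E : x - (a + l) + l = x - a by ring.
by rewrite E in E2; apply/idP/idP; lra.
Qed.

Lemma sawtooth_bounded c : exists M, forall x, `|sawtooth c x| <= M.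
Proof.
exists (1 + `|c| + `|c|) => x; have := frac_part_itv x; rewrite /sawtooth.
move: (frac_part x) => y hy.
rewrite (le_trans (ler_normB _ _)) // lerD //.
  rewrite /Num.min; case: ifP => _; rewrite ?lerDr // (le_trans (_ : _ <= 1)) ?lerDl //.
  by rewrite ger0_norm; lra.
by rewrite normrM ler_piMr // ger0_norm; lra.
Qed.

(** With [c = l + sg], the slope is [1 - c] on the arc of length [c] and [- c] off it, and a path of
    length below [sg] that starts in the arc of length [l] does not leave the larger arc. If [c]
    exceeds 1, the function only jumps upwards at integers, which preserves the inequality. *)
Lemma sawtooth_incr l sg x y : 0 < sg <= 1 -> 0 <= l -> 0 < y < sg ->
  y * ((frac_part x < l)%R%:R - (l + sg)) <= sawtooth (l + sg) (x + y) - sawtooth (l + sg) x.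
Proof.
move=> hs l0 hy; rewrite /sawtooth; have hx := frac_part_itv x; set c := l + sg.
have h1 : 0 <= c * y by rewrite mulr_ge0 /c; lra.
have [|[E1 E2]|[E1 E2]] := frac_partD x y; first by lra.
all: rewrite E2; move: (frac_part x) hx E1 E2 => t hx E1 _.
all: rewrite /Num.min; case: (ltP t l) => tl; case: ltP => h2; case: ltP => h3.
all: rewrite /= ?mulr1n ?mulr0n; rewrite /c in h1 h2 h3 *; lra.
Qed.

End Arc.

Section Equidistribution.
Context {R : realType} (g : 'M[R]_2).
Hypothesis hg : g \in unitmx.
Implicit Types (v w h k : 'cV[int]_2) (r : R).

(** Dirichlet's pigeonhole argument: the [M * M] points of a box have inner products with [v] in an
    interval of length proportional to [M * image_norm g v], so two of them nearly agree for large
    [M]. Their difference, with the right sign, is the step. The box is the same for all [v]. *)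
Lemma small_inner_product (s : R) : 0 < s -> exists2 H : seq 'cV[int]_2, 0 \notin H &
  forall v, exists2 h, h \in H & 0 <= inner g h v <= s * image_norm g v.
Proof.
move=> s0; have n1 := norm_bound_ge1 g; set N := norm_bound g in n1 *.
(* Chosen so that [M * M] exceeds the number of cells, which is at most [2 * N * M / s + 1]. *)
pose M := (Num.truncn (2 * N / s + 1)).+1.
have hM : 2 * N / s + 1 < M%:R by exact: truncnS_gt.
have Ns : 0 <= 2 * N / s by rewrite divr_ge0 ?ltW //; lra.
pose vec (p : 'I_M * 'I_M) : 'cV[int]_2 := \col_i (if i == 0 then p.1 : nat else p.2)%:Z.
pose H := [seq x <- [seq vec p - vec q | p <- enum {: 'I_M * 'I_M}, q <- enum {: 'I_M * 'I_M}]
  | x != 0].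
exists H; first by rewrite mem_filter eqxx.
have inH p q : p != q -> vec p - vec q \in H.
  move=> pq; rewrite mem_filter; apply/andP; split; last first.
    by apply: allpairs_f; rewrite mem_enum.
  apply: contra pq; rewrite subr_eq0 => /eqP/matrixP E.
  have := E 0 0; have := E 1 0; rewrite !mxE /= => -[e2] [e1].
  by apply/eqP; case: p q e1 e2 {E} => p1 p2 [q1 q2] /= /val_inj -> /val_inj ->.
have vec_norm p : image_norm g (vec p) <= N * M%:R.
  apply: image_norm_le => i; rewrite mxE.
  by case: ifP => _; rewrite ger0_norm // -pmulrn ler_nat ltnW // ltn_ord.
move=> v; set nu := image_norm g v.
suff [p [q [pq hpq]]] : exists p q, p != q /\ `|inner g (vec p) v - inner g (vec q) v| <= s * nu.
  have [h|h] := leP 0 (inner g (vec p) v - inner g (vec q) v).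
    by exists (vec p - vec q); rewrite ?inH // innerBl h -(ger0_norm h).
  exists (vec q - vec p); first by rewrite inH // eq_sym.
  by rewrite innerBl; move: hpq; rewrite ler_norml; lra.
have M2 : (1 < M)%N by rewrite -(ltr_nat R); lra.
(* If [nu] is 0, all inner products with [v] are 0 and any two distinct points of the box serve. *)
have [nu0|nu0] := eqVneq nu 0.
  exists (Ordinal (ltnW M2), Ordinal (ltnW M2)), (Ordinal M2, Ordinal M2); split => //.
  have z p : inner g (vec p) v = 0.
    by have := image_norm_inner g (vec p) v; rewrite -/nu nu0 mulr0 normr_le0 => /eqP.
  by rewrite !z subrr normr0 nu0 mulr0.
have nup : 0 < nu by rewrite lt_neqAle eq_sym nu0 image_norm_ge0.
(* Scaled so that a unit cell corresponds to a difference of [s * nu], and translated to be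
   nonnegative for [Num.truncn]. *)
pose x p := (inner g (vec p) v / nu + N * M%:R) / s.
have hx p : 0 <= x p <= 2 * N * M%:R / s.
  have : `|inner g (vec p) v / nu| <= N * M%:R.
    rewrite normrM normfV (gtr0_norm nup) ler_pdivrMr //.
    by rewrite (le_trans (image_norm_inner _ _ _)) // ler_pM2r.
  rewrite ler_norml /x => hh; rewrite divr_ge0 ?(ltW s0) //=; last by lra.
  by rewrite ler_pM2r ?invr_gt0 //; lra.
pose K := Num.truncn (2 * N * M%:R / s).
have xK p : (Num.truncn (x p) < K.+1)%N.
  by rewrite ltnS le_truncn //; have /andP[] := hx p.
pose f p : 'I_K.+1 := Ordinal (xK p).
have card_lt : (K.+1 < #|{: 'I_M * 'I_M}|)%N.
  rewrite card_prod card_ord -(ltr_nat R) natrM -natr1.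
  have hK : K%:R <= 2 * N * M%:R / s.
    by rewrite truncn_le; have /andP[] := hx (Ordinal (ltnW M2), Ordinal M2); lra.
  have E : 2 * N * M%:R / s = (2 * N / s) * M%:R by ring.
  have M1 : 1 < M%:R :> R by rewrite ltr1n.
  by rewrite E in hK; nra.
have /injectivePn[p [q pq fpq]] : ~~ injectiveb f.
  by apply/negP => /injectiveP /leq_card; rewrite card_ord leqNgt card_lt.
exists p, q; split => //.
have E : Num.truncn (x p) = Num.truncn (x q) by have := congr1 val fpq.
have /andP[p1 _] := hx p; have /andP[q1 _] := hx q.
have tp := truncn_itv p1; have tq := truncn_itv q1; rewrite -E in tq.
have dx : `|x p - x q| <= 1 by rewrite ler_norml; rewrite -natr1 in tp tq; lra.
have -> : inner g (vec p) v - inner g (vec q) v = (x p - x q) * (s * nu).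
  by rewrite /x; field; rewrite ?gt_eqF.
have sn : 0 < s * nu by rewrite mulr_gt0.
by rewrite normrM (gtr0_norm sn) ler_piMl // ltW.
Qed.

(** A Lipschitz substitute for the indicator of [(0, s)]: it selects the steps with a usable
    increment while keeping the weights slowly oscillating. *)
Definition tent (s x : R) : R := Num.max 0 (Num.min x (s - x)).

(** The normalising factor: after division by it, the inequalities for the single steps add up to
    one with coefficient 1. *)
Definition weight (s : R) (H : seq 'cV[int]_2) v : R :=
  \sum_(h <- H) tent s (incr g h v) * incr g h v.

Lemma tent_ge0 s x : 0 <= tent s x.
Proof. by rewrite /tent le_max lexx. Qed.

Lemma tent_support s x : tent s x != 0 -> 0 < x < s.
Proof.
rewrite /tent /Num.max /Num.min; case: ifP; case: ifP; rewrite ?eqxx //; lra.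
Qed.

Lemma tent_lipschitz s x y : `|tent s x - tent s y| <= 1 * `|x - y|.
Proof.
rewrite mul1r /tent /Num.max /Num.min; have := ler_norm (x - y); have := ler_norm (y - x).
rewrite (distrC y) => h1 h2; rewrite ler_norml.
by case: (ltP x _) => ?; case: (ltP y _) => ?; case: ltP => ?; case: ltP => ?; lra.
Qed.

Lemma tent_mul_ge0 s x : 0 <= tent s x * x.
Proof.
have [->|/tent_support h] := eqVneq (tent s x) 0; first by rewrite mul0r.
by rewrite mulr_ge0 ?tent_ge0 //; lra.
Qed.

Lemma weight_slow s H : slowly_oscillating g (weight s H).
Proof.
apply: slow_sum => h; apply: slowM; last exact: incr_slow.
by apply: slow_comp (tent_lipschitz s) _; exact: incr_slow.
Qed.

(* The directions in which every increment along [H] is too small to be useful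
   lie close to the finitely many lines orthogonal to a vector of [H]. *)
Lemma weight_small_count (s e : R) : 0 < s -> 0 < e ->
  exists (H : seq 'cV[int]_2) (kap : R), 0 < kap /\ \forall r \near +oo,
    \sum_(v <- norm_ball g r) (weight s H v < kap)%R%:R <= e * r ^+ 2.
Proof.
move=> s0 e0; have s2 : 0 < s / 2 by lra.
have [H H0 hH] := small_inner_product (s / 2) s2.
have e2 : 0 < e / 2 by lra.
have [d0 d00 hd0] := strips_count g hg H (e / 2) H0 e2.
pose d := Num.min d0 (s / 2); have dp : 0 < d by rewrite lt_min d00.
have dd0 : d <= d0 by rewrite ge_min lexx.
have ds : d <= s / 2 by rewrite ge_min lexx orbT.
(* For [v] far out and away from the strips, some step has an increment between [d / 2] and
   [s - d / 2]. Its tent value and its increment are then both at least [d / 2]. *)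
exists H, (d ^+ 2 / 4); split; first by rewrite divr_gt0 ?exprn_gt0.
pose B := \sum_(h <- H) 2 * image_norm g h ^+ 2.
have B0 : 0 <= B by rewrite sumr_ge0 // => h _; rewrite mulr_ge0 ?sqr_ge0.
have hB h : h \in H -> 2 * image_norm g h ^+ 2 <= B.
  move=> hh; rewrite /B (big_rem h) //= lerDl sumr_ge0 // => k _.
  by rewrite mulr_ge0 ?sqr_ge0.
have [rho0 hrho0] := inv_norm_vanishing g B (d / 4) (divr_gt0 dp (ltr0Sn _ 3)).
pose rho := Num.max 1 rho0.
have key v r : image_norm g v <= r -> (weight s H v < d ^+ 2 / 4)%R%:R <=
    (image_norm g v < rho)%R%:R * 1 + \sum_(h <- H) (`|inner g h v| <= d * r)%R%:R :> R.
  move=> vr; have S0 : 0 <= \sum_(h <- H) (`|inner g h v| <= d * r)%R%:R :> R.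
    by rewrite sumr_ge0.
  case: ltP => [wv|_]; last by rewrite addr_ge0 // mulr1.
  have [vrho|vrho] := ltP (image_norm g v) rho; first by rewrite mulr1 lerDl.
  rewrite mul0r add0r.
  move: vrho; rewrite ge_max => /andP[v1 /hrho0 vB].
  have v0 : 0 < image_norm g v by lra.
  have [h hh /andP[i0 i1]] := hH v.
  have [small|large] := leP (inner g h v) (d * image_norm g v).
    rewrite (big_rem h) //= ger0_norm // (le_trans small) ?ler_pM2l //.
    by rewrite lerDl sumr_ge0.
  exfalso; move: wv; apply/negP; rewrite -leNgt.
  have ia := incr_approx g h v v0.
  have hs1 : d < inner g h v / image_norm g v by rewrite ltr_pdivlMr.
  have hs2 : inner g h v / image_norm g v <= s / 2 by rewrite ler_pdivrMr.
  have ib : 2 * image_norm g h ^+ 2 / image_norm g v <= d / 4.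
    apply: le_trans vB; apply: le_trans (ler_norm _).
    by rewrite ler_pM2r ?invr_gt0 // hB.
  have hc : d / 2 <= incr g h v <= s / 2 + d / 4.
    by have := le_trans ia ib; rewrite ler_norml; lra.
  have ht : d / 2 <= tent s (incr g h v).
    by rewrite /tent le_max le_min; apply/orP; right; lra.
  rewrite /weight (big_rem h) //= ler_wpDr ?sumr_ge0 // => [k _|]; first exact: tent_mul_ge0.
  have -> : d ^+ 2 / 4 = (d / 2) * (d / 2) by field.
  by apply: ler_pM; rewrite ?divr_ge0 ?(ltW dp) //; lra.
near=> r.
apply: (le_trans (sum_norm_ball_le g hg _ _ r (fun v => key v r))).
rewrite big_split /= (_ : e * r ^+ 2 = e / 2 * r ^+ 2 + e / 2 * r ^+ 2); last by field.
apply: lerD; last by near: r; apply: hd0; rewrite dp.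
apply: (le_trans (sum_norm_ball_cut g hg (fun=> 1) rho r (fun=> ler01))).
set S := \sum_(v <- _) _.
suff : 0 * r + S <= e / 2 * r ^+ 2 by rewrite mul0r add0r.
by near: r; apply: le_affine_sqr; rewrite divr_gt0.
Unshelve. all: by end_near. Qed.

Lemma arc_upper_bound (a l : R) : 0 <= l <= 1 -> forall e : R, 0 < e ->
  \forall r \near +oo,
    \sum_(v <- norm_ball g r) ((in_arc a l (image_norm g v))%:R - l) <= e * r ^+ 2.
Proof.
move=> hl e e0.
have c1 := coord_bound_ge1 g; set A := (2 * coord_bound g + 1) ^+ 2.
have A1 : 1 <= A by rewrite expr_ge1 //; lra.
have A0 : 0 < A by lra.
have e3 : 0 < e / 3 by lra.
(* Enlarging the arc by [s] costs [s] for each of the at most [A * r ^+ 2] vectors; [sawtooth_incr]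
   requires [s <= 1]. *)
pose s := Num.min 1 (e / 3 / A).
have s0 : 0 < s by rewrite lt_min ltr01 divr_gt0.
have s1 : s <= 1 by rewrite ge_min lexx.
have sA : s * A <= e / 3 by rewrite -ler_pdivlMr // ge_min lexx orbT.
have [H [kap [k0 hH]]] := weight_small_count s (e / 3) s0 e3.
pose F v := sawtooth (l + s) (image_norm g v - a).
have bF : fun_bounded F by have [M hM] := sawtooth_bounded (l + s); exists M => v; exact: hM.
(* Cutting off at [kap] makes the reciprocal a Lipschitz function of the weight, with constant
   [kap ^- 2]. *)
pose psi h v := tent s (incr g h v) * (Num.max (weight s H v) kap)^-1.
have mk0 x : 0 < Num.max x kap by rewrite lt_max k0 orbT.
have psi_slow h : slowly_oscillating g (psi h).
  apply: slowM; first by apply: slow_comp (tent_lipschitz s) _; exact: incr_slow.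
  apply: (slow_comp _ _ (fun x => (Num.max x kap)^-1) (kap ^- 2)); last exact: weight_slow.
  move=> x y; have mx := mk0 x; have my := mk0 y.
  have -> : (Num.max x kap)^-1 - (Num.max y kap)^-1 =
      (Num.max y kap - Num.max x kap) / (Num.max x kap * Num.max y kap).
    by field; rewrite !gt_eqF.
  rewrite normrM normfV (gtr0_norm (mulr_gt0 mx my)) ler_pdivrMr ?mulr_gt0 //.
  have h1 : `|Num.max y kap - Num.max x kap| <= `|x - y|.
    rewrite /Num.max; have := ler_norm (x - y); have := ler_norm (y - x).
    rewrite (distrC y) => h1 h2; rewrite ler_norml.
    by case: ltP => ?; case: ltP => ?; lra.
  apply: (le_trans h1); rewrite mulrAC -[leLHS]mul1r ler_wpM2r //.
  rewrite mulrC ler_pdivlMr ?exprn_gt0 // mul1r expr2.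
  by apply: ler_pM; rewrite ?(ltW k0) ?le_max ?lexx ?orbT //.
have hneg := density_null_sum g _ H _ (fun h => slow_shift_density_null g hg _ F h (psi_slow h) bF).
pose E v := (in_arc a l (image_norm g v))%:R - (l + s).
have psi0 h v : 0 <= psi h v by rewrite mulr_ge0 ?tent_ge0 // invr_ge0 ltW.
have E1 v : E v <= 1 by rewrite /E; case: in_arc => /=; lra.
have term h v : psi h v * incr g h v * E v <= psi h v * (F (v + h) - F v).
  rewrite -mulrA; have [->|pz] := eqVneq (psi h v) 0; first by rewrite !mul0r.
  rewrite ler_wpM2l //.
  have tz : tent s (incr g h v) != 0 by apply: contra pz => /eqP t0; rewrite /psi t0 mul0r.
  have hi := tent_support _ _ tz.
  have := sawtooth_incr l s (image_norm g v - a) (incr g h v).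
  rewrite s0 s1; have /andP[l0 _] := hl => /(_ isT l0 hi); rewrite /F.
  by have -> : image_norm g v - a + incr g h v = image_norm g (v + h) - a by rewrite /incr; ring.
have sumpsi v : \sum_(h <- H) psi h v * incr g h v = weight s H v / Num.max (weight s H v) kap.
  by rewrite /weight mulr_suml; apply: eq_bigr => h _; rewrite /psi mulrAC.
have w0 v : 0 <= weight s H v by rewrite sumr_ge0 // => h _; exact: tent_mul_ge0.
(* Where the weight reaches [kap], the total coefficient of [E v] is 1. Elsewhere it is some [t] in
   [[0, 1]], and the missing [(1 - t) * E v] is at most 1. *)
have point v : E v <= \sum_(h <- H) psi h v * (F (v + h) - F v) + (weight s H v < kap)%R%:R.
  apply: (@le_trans _ _ ((\sum_(h <- H) psi h v * incr g h v) * E v +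
      (weight s H v < kap)%R%:R)); last first.
    by rewrite lerD2r mulr_suml ler_sum.
  rewrite sumpsi; have mx := mk0 (weight s H v).
  have [wk|wk] := ltP (weight s H v) kap.
    set t := _ / _; have t1 : 0 <= t <= 1.
      by rewrite /t divr_ge0 ?w0 ?(ltW k0) //= ler_pdivrMr // mul1r ltW.
    by have := E1 v; rewrite mulr1n; move: (E v) => x; nra.
  by rewrite divff ?mul1r ?addr0 // gt_eqF // (lt_le_trans k0).
near=> r.
have r1 : 1 <= r by near: r; apply: nbhs_pinfty_ge; rewrite num_real.
have -> : \sum_(v <- norm_ball g r) ((in_arc a l (image_norm g v))%:R - l) =
    \sum_(v <- norm_ball g r) E v + s * #|` norm_ball g r|%:R.
  have -> : s * #|` norm_ball g r|%:R = \sum_(v <- norm_ball g r) s.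
    by rewrite big_const_seq count_predT iter_addr_0 mulr_natr.
  by rewrite -big_split /=; apply: eq_bigr => v _; rewrite /E; ring.
have b1 : s * #|` norm_ball g r|%:R <= e / 3 * r ^+ 2.
  apply: (@le_trans _ _ (s * (A * r ^+ 2))).
    by rewrite ler_pM2l // card_norm_ball_sqr.
  by rewrite mulrA ler_wpM2r ?sqr_ge0.
have b2 : \sum_(v <- norm_ball g r) (weight s H v < kap)%R%:R <= e / 3 * r ^+ 2 by near: r.
have b3 : `|\sum_(v <- norm_ball g r) \sum_(h <- H) psi h v * (F (v + h) - F v)| <= e / 3 * r ^+ 2.
  by near: r; exact: hneg.
have b4 : \sum_(v <- norm_ball g r) E v <= e / 3 * r ^+ 2 + e / 3 * r ^+ 2.
  apply: (le_trans (ler_sum _ (fun v _ => point v))); rewrite big_split /= lerD //.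
  exact: le_trans (ler_norm _) b3.
lra.
Unshelve. all: by end_near. Qed.

Lemma arc_density_null (a l : R) : 0 <= l <= 1 ->
  density_null g (fun v => (in_arc a l (image_norm g v))%:R - l).
Proof.
move=> hl e e0; have hl' : 0 <= 1 - l <= 1 by lra.
near=> r; rewrite ler_norml; apply/andP; split; last by near: r; exact: arc_upper_bound.
rewrite lerNl -sumrN; near: r.
have := arc_upper_bound (a + l) (1 - l) hl' e e0; apply: filterS => r.
congr (_ <= _); apply: eq_bigr => v _; rewrite in_arcC //.
by case: in_arc => /=; ring.
Unshelve. all: by end_near. Qed.

End Equidistribution.

(** * Passing to primitive vectors *)

Definition divides (p : nat) (v : 'cV[int]_2) : bool :=
  (p%:Z %| (v 0 0)%R)%Z && (p%:Z %| (v 1 0)%R)%Z.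

Definition primitive (v : 'cV[int]_2) : bool := coprimez (v 0 0) (v 1 0).

Definition content (v : 'cV[int]_2) : nat := gcdn (absz (v 0 0)%R) (absz (v 1 0)%R).

Definition avoids (s : seq nat) (v : 'cV[int]_2) : bool := all (fun p => ~~ divides p v) s.

Section Divisibility.
Implicit Types (v w : 'cV[int]_2) (p q d n : nat).

Lemma col2P v w : v 0 0 = w 0 0 -> v 1 0 = w 1 0 -> v = w.
Proof.
move=> e0 e1; apply/matrixP => i j; rewrite ord1.
by have [->|->] := ord2_cases i.
Qed.

Lemma mulrn_entry v p i : (v *+ p) i 0 = v i 0 * p%:Z.
Proof. by rewrite mulmxnE -mulr_natr natz. Qed.

Definition quot v p : 'cV[int]_2 := \col_i ((v i 0)%R %/ p%:Z)%Z.

Lemma quotK v p : divides p v -> quot v p *+ p = v.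
Proof.
by move=> /andP[d0 d1]; apply: col2P; rewrite mulrn_entry mxE divzK.
Qed.

Lemma mulrn_quot v p : (0 < p)%N -> quot (v *+ p) p = v.
Proof.
by move=> p0; apply: col2P; rewrite mxE mulrn_entry mulzK //; lia.
Qed.

Lemma divides_mulrn v p : divides p (v *+ p).
Proof. by rewrite /divides !mulrn_entry !dvdz_mull. Qed.

Lemma divides_coprime q p v : coprime q p -> divides q (v *+ p) = divides q v.
Proof. by move=> qp; rewrite /divides !mulrn_entry !Gauss_dvdzl. Qed.

Lemma avoids_mulrn s p v : prime p -> all prime s -> p \notin s ->
  avoids s (v *+ p) = avoids s v.
Proof.
move=> pp /allP ps pns; apply: eq_in_all => q qs; congr (~~ _).
apply: divides_coprime; rewrite prime_coprime ?dvdn_prime2 ?(ps q qs) //.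
by apply: contraNneq pns => <-.
Qed.

Lemma divides_gcd p v : divides p v = (p %| content v)%N.
Proof. by rewrite /divides /content !dvdzE dvdn_gcd. Qed.

Lemma primitive_gcd v : primitive v = (content v == 1)%N.
Proof. by rewrite /primitive /coprimez. Qed.

Lemma gcd_gt0 v : v != 0 -> (0 < content v)%N.
Proof.
rewrite /content gcdn_gt0 !absz_gt0; apply: contraR.
rewrite negb_or !negbK => /andP[/eqP e0 /eqP e1].
by apply/eqP/col2P; rewrite mxE.
Qed.

Lemma primitive_quot v : v != 0 ->
  primitive (quot v (content v)).
Proof.
move=> /gcd_gt0; set d := content v => d0.
have E : quot v d *+ d = v by apply: quotK; rewrite divides_gcd.
have : d = (content (quot v d) * d)%N.
  rewrite {1}/d -{1}E /content !mulrn_entry !abszM /=.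
  by rewrite muln_gcdl.
by rewrite primitive_gcd; set m := content _; nia.
Qed.

(** The zero vector is divisible by every integer and would spoil counts that decay with [n]. *)
Definition large_factor n v : bool := (v != 0) && `[< exists2 p, (n < p)%N & divides p v >].

(** The content of a nonzero vector that is not primitive has a prime divisor, which exceeds [n] if
    the vector survives the sieve. As [1 < n], the prime 2 is in the list and removes the zero
    vector. *)
Lemma primitive_sieve n v : (1 < n)%N ->
  let s := [seq p <- iota 0 n.+1 | prime p] in
  (primitive v -> avoids s v) /\ (avoids s v -> ~~ primitive v -> large_factor n v).
Proof.
move=> n1 s; split.
  rewrite primitive_gcd => /eqP g1; apply/allP => p; rewrite mem_filter => /andP[pp _].
  by rewrite divides_gcd g1 dvdn1; apply: contraL pp => /eqP ->.
move=> /allP av; rewrite primitive_gcd => g1.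
have ins p : prime p -> (p <= n)%N -> p \in s by move=> pp pn; rewrite mem_filter pp mem_iota.
have v0 : v != 0.
  by apply/eqP => v0; have := av 2%N (ins 2%N isT n1); rewrite v0 /divides !mxE.
rewrite /large_factor v0; apply/asboolP; have c0 := gcd_gt0 v v0.
have pp : prime (pdiv (content v)) by apply: pdiv_prime; lia.
exists (pdiv (content v)); last by rewrite divides_gcd pdiv_dvd.
rewrite ltnNge; apply/negP => le_n.
by have := av _ (ins _ pp le_n); rewrite divides_gcd pdiv_dvd.
Qed.

End Divisibility.

(** Each term is at most [1 / (m * (m + 1))], which telescopes. *)
Lemma sum_inv_sqr_le {R : realType} (n K : nat) : (0 < n)%N ->
  \sum_(n <= m < K) (m.+1%:R ^+ 2)^-1 <= n%:R^-1 :> R.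
Proof.
move=> n0; have [nK|Kn] := leqP n K; last by rewrite big_geq ?invr_ge0 // ltnW.
have -> : n%:R^-1 = K%:R^-1 + \sum_(n <= m < K) (m%:R^-1 - m.+1%:R^-1) :> R.
  rewrite (telescope_sumr_eq (fun m => - (m%:R^-1 : R))) //; first by ring.
  by move=> m _; ring.
rewrite ler_wpDl ?invr_ge0 // big_nat [leRHS]big_nat ler_sum // => m /andP[nm _].
have m0 : 0 < m%:R :> R by rewrite ltr0n (leq_trans n0).
rewrite -natr1.
have -> : m%:R^-1 - (m%:R + 1)^-1 = (m%:R * (m%:R + 1))^-1 :> R.
  by field; rewrite !gt_eqF // ltr_wpDl.
rewrite lef_pV2 ?posrE ?mulr_gt0 ?exprn_gt0 ?ltr_wpDl //; nra.
Qed.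

Lemma ler_sum_fsubset {R : realType} (T : choiceType) (A B : {fset T}) (X : T -> R) :
  (A `<=` B)%fset -> (forall x, 0 <= X x) -> \sum_(x <- A) X x <= \sum_(x <- B) X x.
Proof.
move=> AB X0; rewrite [leRHS](big_fsetID _ (mem A)) /= ler_wpDr ?sumr_ge0 //.
rewrite le_eqVlt; apply/orP; left; apply/eqP; apply: eq_fbigl => x; rewrite !inE /=.
by case: (boolP (x \in A)) => [/(fsubsetP AB) ->|]; rewrite ?andbF.
Qed.

(** * The sieve over the primes *)

Section Sieve.
Context {R : realType}.
Implicit Types (g : 'M[R]_2) (v w : 'cV[int]_2) (r : R) (X : 'cV[int]_2 -> R).

Lemma unitmx_scale g p : g \in unitmx -> (0 < p)%N -> p%:R *: g \in unitmx.
Proof. by move=> hg p0; rewrite unitmxZ // unitfE pnatr_eq0 -lt0n. Qed.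

(** Substitution [v = w *+ p], whose norm for [g] is the norm of [w] for [p%:R *: g]. *)
Lemma sum_divides g p X r : g \in unitmx -> (0 < p)%N ->
  \sum_(v <- norm_ball g r) (divides p v)%:R * X v =
  \sum_(w <- norm_ball (p%:R *: g) r) X (w *+ p).
Proof.
move=> hg p0; have hpg := unitmx_scale g p hg p0.
under eq_bigr do rewrite mulr_natl mulrb.
rewrite -big_mkcond /= big_fset_condE /=.
transitivity (\sum_(v <- [fset (w *+ p)%R | w in norm_ball (p%:R *: g) r]%fset) X v).
  apply: eq_fbigl => v; rewrite !inE /= in_norm_ball //.
  apply/andP/imfsetP => [[vr pv]|[w /=]]; last first.
    rewrite in_norm_ball // image_normM ?ler0n // -image_norm_mulrn => wr ->.
    by rewrite divides_mulrn.
  exists (quot v p); rewrite /= ?quotK //.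
  by rewrite in_norm_ball // image_normM ?ler0n // -image_norm_mulrn quotK.
rewrite big_imfset //= => v w _ _ E.
by rewrite -(mulrn_quot v p p0) -(mulrn_quot w p p0) E.
Qed.

Lemma norm_ball_scale g p r : g \in unitmx -> (0 < p)%N ->
  norm_ball (p%:R *: g) r = norm_ball g (r / p%:R).
Proof.
move=> hg p0; have hpg := unitmx_scale g p hg p0.
apply/fsetP => v; rewrite !in_norm_ball // image_normM ?ler0n //.
by rewrite ler_pdivlMr ?ltr0n // mulrC.
Qed.

(** Induction on the list with [g] quantified inside, since sieving by [p] brings in [p%:R *: g]. As
    [p] differs from the remaining primes, [w *+ p] avoids them exactly when [w] does. *)
Lemma avoids_density_null (a l : R) (s : seq nat) : 0 <= l <= 1 -> uniq s -> all prime s ->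
  forall g, g \in unitmx ->
  density_null g (fun v => (avoids s v)%:R * ((in_arc a l (image_norm g v))%:R - l)).
Proof.
move=> hl; elim: s => [_ _ g hg|p s IH /= /andP[ps us] /andP[pp sp] g hg].
  by apply: density_null_eq (arc_density_null g hg a l hl) => v; rewrite mul1r.
have p0 := prime_gt0 pp; have hpg := unitmx_scale g p hg p0.
have h1 := IH us sp _ hg; have h2 := density_nullN _ _ (IH us sp _ hpg).
move=> e e0; have e2 : 0 < e / 2 by lra.
near=> r.
have -> : \sum_(v <- norm_ball g r) (avoids (p :: s) v)%:R *
      ((in_arc a l (image_norm g v))%:R - l) =
    \sum_(v <- norm_ball g r) (avoids s v)%:R * ((in_arc a l (image_norm g v))%:R - l) +
    \sum_(v <- norm_ball (p%:R *: g) r)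
      - ((avoids s v)%:R * ((in_arc a l (image_norm (p%:R *: g) v))%:R - l)).
  transitivity (\sum_(v <- norm_ball g r) (
      (avoids s v)%:R * ((in_arc a l (image_norm g v))%:R - l) +
      (divides p v)%:R * - ((avoids s v)%:R * ((in_arc a l (image_norm g v))%:R - l)))).
    apply: eq_bigr => v _; rewrite /avoids /=.
    by case: divides; case: all; rewrite /= ?mulr1n ?mulr0n; ring.
  rewrite big_split /= sum_divides //; congr (_ + _); apply: eq_bigr => v _.
  by rewrite avoids_mulrn // image_normM ?ler0n // image_norm_mulrn.
rewrite (le_trans (ler_normD _ _)) //.
rewrite (_ : e * r ^+ 2 = e / 2 * r ^+ 2 + e / 2 * r ^+ 2); last by field.
by apply: lerD; near: r; [exact: h1|exact: h2].
Unshelve. all: by end_near. Qed.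

(** If [C * r < 1], the ball contains only the zero vector; otherwise [2 * C * r + 1] is at most
    [3 * C * r]. Without the zero vector the bound is homogeneous in [r] and can be summed over
    divisors. *)
Lemma count_nonzero g r : g \in unitmx -> 0 <= r ->
  \sum_(v <- norm_ball g r) (v != 0)%:R <= 9 * coord_bound g ^+ 2 * r ^+ 2.
Proof.
move=> hg r0; have c1 := coord_bound_ge1 g; set C := coord_bound g in c1 *.
have C0 : 0 <= C by lra.
have Cr0 : 0 <= C * r by rewrite mulr_ge0.
have [Cr|Cr] := ltP (C * r) 1.
  rewrite big_seq big1 ?mulr_ge0 ?sqr_ge0 // => v; rewrite in_norm_ball // => vr.
  suff -> : v = 0 by rewrite eqxx.
  have z i : v i 0 = 0.
    have := ball_coord g hg r v i vr; rewrite -/C.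
    have -> : Num.truncn (C * r) = 0%N by apply/eqP; rewrite -leqn0 truncn_le_nat.
    by rewrite normr_le0 => /eqP.
  by apply: col2P; rewrite mxE z.
apply: (@le_trans _ _ #|` norm_ball g r|%:R).
  rewrite card_fset_sum1 natr_sum ler_sum // => v _; by case: eqP.
apply: (le_trans (card_norm_ball g hg r r0)); rewrite -/C.
have -> : 9 * C ^+ 2 * r ^+ 2 = (3 * (C * r)) ^+ 2 by ring.
by rewrite ler_sqr ?nnegrE; lra.
Qed.

(** Union bound over the divisors [m.+1] with [n <= m < K]: the nonzero multiples of [m.+1] are
    counted in a ball of radius [r / m.+1]. A divisor of a nonzero vector is at most one of its
    coordinates in absolute value, hence at most [K]. *)
Lemma large_factor_count g n r : g \in unitmx -> (0 < n)%N -> 0 <= r ->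
  \sum_(v <- norm_ball g r) (large_factor n v)%:R <= 9 * coord_bound g ^+ 2 * r ^+ 2 / n%:R.
Proof.
move=> hg n0 r0; set K := Num.truncn (coord_bound g * r).
apply: (@le_trans _ _ (\sum_(v <- norm_ball g r) \sum_(n <= m < K)
    (divides m.+1 v)%:R * (v != 0)%:R)).
  apply: sum_norm_ball_le => // v vr; rewrite /large_factor.
  case: eqP => [_|/eqP v0] /=; first by rewrite sumr_ge0 // => m _; rewrite mulr_ge0.
  case: asboolP => [[p np pv]|_]; last by rewrite sumr_ge0 // => m _; rewrite mulr_ge0.
  have pK : (p <= K)%N.
    have [i vi] : exists i, v i 0 != 0.
      apply/not_existsP => z; move/eqP: v0; apply; apply: col2P; rewrite mxE.
        by apply/eqP; have := z 0; move/negP; rewrite negbK.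
      by apply/eqP; have := z 1; move/negP; rewrite negbK.
    have := ball_coord g hg r v i vr; rewrite -/K -abszE lez_nat; apply: leq_trans.
    apply: dvdn_leq; first by rewrite absz_gt0.
    have := pv; rewrite /divides !dvdzE => /andP[d0 d1].
    by have [->|->] := ord2_cases i.
  case: p np pv pK => // p np pv pK.
  rewrite (bigD1_seq p) /= ?mem_index_iota ?iota_uniq // ?pv ?mulr1 ?lerDl;
    last by rewrite -ltnS np.
  by rewrite sumr_ge0 // => m _; rewrite mulr_ge0.
rewrite exchange_big /=.
apply: (@le_trans _ _ (\sum_(n <= m < K) 9 * coord_bound g ^+ 2 * r ^+ 2 * (m.+1%:R ^+ 2)^-1)).
  apply: ler_sum => m _; rewrite sum_divides // norm_ball_scale //.
  have E : 9 * coord_bound g ^+ 2 * r ^+ 2 * (m.+1%:R ^+ 2)^-1 =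
      9 * coord_bound g ^+ 2 * (r / m.+1%:R) ^+ 2 by rewrite expr_div_n; ring.
  rewrite E; apply: le_trans (count_nonzero g _ hg (divr_ge0 r0 (ler0n _ _))).
  apply: ler_sum => v _; rewrite ler_nat; case: (eqVneq v 0) => [->|_]; last exact: leq_b1.
  by rewrite mul0rn eqxx.
rewrite -mulr_sumr ler_wpM2l ?sum_inv_sqr_le //.
by rewrite mulr_ge0 ?sqr_ge0 // mulr_ge0 ?sqr_ge0.
Qed.

Lemma primitive_density_null (a l : R) g : 0 <= l <= 1 -> g \in unitmx ->
  density_null g (fun v => (primitive v)%:R * ((in_arc a l (image_norm g v))%:R - l)).
Proof.
move=> hl hg e e0; have e2 : 0 < e / 2 by lra.
have c1 := coord_bound_ge1 g; set A := 9 * coord_bound g ^+ 2.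
have A0 : 0 < A by rewrite mulr_gt0 // exprn_gt0 //; lra.
(* One successor makes [n] exceed [A / (e / 2)]; the second ensures [1 < n], as the sieve
   requires. *)
pose n := (Num.truncn (A / (e / 2))).+2.
have hn : A / n%:R <= e / 2.
  rewrite ler_pdivrMr ?ltr0n // mulrC -ler_pdivrMr // ltW //.
  by rewrite (lt_le_trans (truncnS_gt _)) // ler_nat.
pose s := [seq p <- iota 0 n.+1 | prime p].
have sP v := primitive_sieve n v isT.
have hs := avoids_density_null a l s hl (filter_uniq _ (iota_uniq _ _)) (filter_all _ _) g hg.
near=> r.
have r0 : 0 <= r by near: r; apply: nbhs_pinfty_ge; rewrite num_real.
pose E v := (in_arc a l (image_norm g v))%:R - l.
have E1 v : `|E v| <= 1 by rewrite /E ler_norml; case: in_arc; rewrite /= ?mulr1n ?mulr0n; lra.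
have -> : \sum_(v <- norm_ball g r) (primitive v)%:R * E v =
    \sum_(v <- norm_ball g r) (avoids s v)%:R * E v +
    \sum_(v <- norm_ball g r) ((primitive v)%:R - (avoids s v)%:R) * E v.
  by rewrite -big_split /=; apply: eq_bigr => v _; ring.
rewrite (le_trans (ler_normD _ _)) //.
rewrite (_ : e * r ^+ 2 = e / 2 * r ^+ 2 + e / 2 * r ^+ 2); last by field.
apply: lerD; first by near: r; exact: hs.
apply: (le_trans (ler_norm_sum _ _ _)).
(* Primitive vectors survive the sieve, so the two indicators differ only at survivors that have a
   large factor. *)
apply: (@le_trans _ _ (\sum_(v <- norm_ball g r) (large_factor n v)%:R)).
  apply: ler_sum => v _; rewrite normrM; have := E1 v; have := normr_ge0 (E v).
  move: (`|E v|) => x x0 x1; have [h1 h2] := sP v; rewrite -/s in h1 h2.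
  case: (boolP (primitive v)) h1 h2 => pv h1 h2.
    by rewrite h1 // subrr normr0 mul0r.
  case: (boolP (avoids s v)) h2 => av h2; last by rewrite subrr normr0 mul0r.
  by rewrite h2 // sub0r normrN normr1 mul1r.
apply: (le_trans (large_factor_count g n r hg isT r0)).
by rewrite -/A mulrAC ler_wpM2r ?sqr_ge0.
Unshelve. all: by end_near. Qed.

(** * Lower bounds of order [r ^+ 2] for the counts *)

Lemma nonzero_lower_bound g : g \in unitmx -> exists2 c : R, 0 < c &
  \forall r \near +oo, c * r ^+ 2 <= \sum_(v <- norm_ball g r) (v != 0)%:R.
Proof.
move=> hg; have n1 := norm_bound_ge1 g; set N := norm_bound g in n1 *.
exists ((2 * N) ^- 2); first by rewrite invr_gt0 exprn_gt0 //; lra.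
near=> r.
(* From here on, rounding [r / N] down to [M] loses at most half, so the box of vectors with
   coordinates from 1 to [M] is large enough. *)
have rN : 2 * N <= r by near: r; apply: nbhs_pinfty_ge; rewrite num_real.
have r0 : 0 <= r by lra.
set M := Num.truncn (r / N).
have hM1 : M%:R <= r / N by rewrite truncn_le divr_ge0 //; lra.
have hM2 : r / N < M%:R + 1 by rewrite natr1 truncnS_gt.
rewrite ltr_pdivrMr in hM2; last by lra.
pose f (p : 'I_M * 'I_M) : 'cV[int]_2 := \col_i (if i == 0 then p.1 : nat else p.2).+1%:Z.
have finj : injective f.
  move=> [p1 p2] [q1 q2] /matrixP E; have := E 0 0; have := E 1 0.
  by rewrite !mxE /= => -[/val_inj ->] [/val_inj ->].
pose S := [fset v in codom f]%fset.
have cS : #|` S| = (M * M)%N.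
  by rewrite card_fseq undup_id ?size_codom ?card_prod ?card_ord // map_inj_uniq ?enum_uniq.
have fn p : f p != 0 by apply/eqP => /matrixP/(_ 0 0); rewrite !mxE.
apply: (@le_trans _ _ (\sum_(v <- S) (v != 0)%:R)); last first.
  apply: ler_sum_fsubset => //; apply/fsubsetP => v; rewrite inE => /codomP[p ->].
  rewrite in_norm_ball //.
  have : image_norm g (f p) <= N * M%:R.
    apply: image_norm_le => i; rewrite mxE ger0_norm // -pmulrn ler_nat.
    by case: ifP => _; exact: ltn_ord.
  by move=> h; apply: (le_trans h); rewrite mulrC -ler_pdivlMr //; lra.
have -> : \sum_(v <- S) (v != 0)%:R = #|` S|%:R :> R.
  rewrite card_fset_sum1 natr_sum big_seq [RHS]big_seq; apply: eq_bigr => v.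
  by rewrite inE => /codomP[p ->]; rewrite fn.
rewrite cS natrM mulrC ler_pdivrMr ?exprn_gt0; last by lra.
have h : r <= M%:R * (2 * N) by lra.
by rewrite expr2 [X in _ <= X](_ : _ = (M%:R * (2 * N)) * (M%:R * (2 * N))); [apply: ler_pM|ring].
Unshelve. all: by end_near. Qed.

(* Every non-zero vector is a multiple of a primitive one, and few vectors are large multiples. *)
Lemma primitive_lower_bound g : g \in unitmx -> exists2 c : R, 0 < c &
  \forall r \near +oo, c * r ^+ 2 <= \sum_(v <- norm_ball g r) (primitive v)%:R.
Proof.
move=> hg; have [c c0 hc] := nonzero_lower_bound g hg.
have c1 := coord_bound_ge1 g; set A := 9 * coord_bound g ^+ 2.
have A0 : 0 < A by rewrite mulr_gt0 // exprn_gt0 //; lra.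
(* Vectors with a factor above [D] then account for at most half of the lower bound [c * r ^+ 2].
   Each content up to [D] contributes at most [P], whence the division by [D] in the final
   constant. *)
pose D := (Num.truncn (A / (c / 2))).+1.
have c2 : 0 < c / 2 by lra.
have D0 : 0 < D%:R :> R by rewrite ltr0n.
have hD : A / D%:R <= c / 2.
  by rewrite ler_pdivrMr // mulrC -ler_pdivrMr // ltW // truncnS_gt.
exists (c / 2 / D%:R); first by rewrite divr_gt0.
near=> r.
have r0 : 0 <= r by near: r; apply: nbhs_pinfty_ge; rewrite num_real.
set P := \sum_(v <- _) _.
have h1 : c * r ^+ 2 <= \sum_(v <- norm_ball g r) (v != 0)%:R by near: r.
have h2 := large_factor_count g D r hg isT r0; rewrite -/A mulrAC in h2.
have h3 : \sum_(v <- norm_ball g r) (v != 0)%:R <=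
    \sum_(v <- norm_ball g r) (large_factor D v)%:R +
    \sum_(v <- norm_ball g r) \sum_(0 <= m < D)
      (divides m.+1 v)%:R * (primitive (quot v m.+1))%:R :> R.
  rewrite -big_split /=; apply: ler_sum => v _.
  have S0 : 0 <= \sum_(0 <= m < D) (divides m.+1 v)%:R * (primitive (quot v m.+1))%:R :> R.
    by rewrite sumr_ge0 // => m _; rewrite mulr_ge0.
  case: (eqVneq v 0) => [_|v0]; first by rewrite addr_ge0.
  rewrite /large_factor v0 /=; case: asboolP => [_|nl]; first by rewrite lerDl.
  have pq := primitive_quot v v0; have d0 := gcd_gt0 v v0.
  set d := content v in pq d0.
  have dv : divides d v by rewrite divides_gcd.
  have dD : (d <= D)%N by rewrite leqNgt; apply/negP => Dd; apply: nl; exists d.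
  have dE : d = d.-1.+1 by rewrite prednK.
  have dD1 : (d.-1 < D)%N by rewrite prednK.
  rewrite add0r (bigD1_seq d.-1) ?mem_index_iota ?iota_uniq ?dD1 //=.
  by rewrite -dE dv pq mulr1 lerDl sumr_ge0 // => m _; rewrite mulr_ge0.
have h4 : \sum_(v <- norm_ball g r) \sum_(0 <= m < D)
    (divides m.+1 v)%:R * (primitive (quot v m.+1))%:R <= D%:R * P.
  rewrite exchange_big /=.
  have -> : D%:R * P = \sum_(0 <= m < D) P.
    by rewrite big_const_nat subn0 iter_addr_0 mulr_natl.
  apply: ler_sum => m _.
  rewrite (sum_divides g m.+1 (fun v => (primitive (quot v m.+1))%:R)) //.
  under eq_bigr do rewrite mulrn_quot //.
  apply: ler_sum_fsubset => //; rewrite norm_ball_scale //.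
  apply/fsubsetP => w; rewrite !in_norm_ball // => h; apply: (le_trans h).
  by rewrite ler_pdivrMr ?ltr0n // ler_peMr // ler1n.
have h5 : A / D%:R * r ^+ 2 <= c / 2 * r ^+ 2 by rewrite ler_wpM2r ?sqr_ge0.
rewrite mulrAC ler_pdivrMr // [P * _]mulrC; lra.
Unshelve. all: by end_near. Qed.

End Sieve.

(** * From mean values to the limit of the proportions *)

Lemma in_arcE {R : realType} (a b x : R) : 0 <= a -> a <= b -> b <= 1 ->
  in_arc a (b - a) x = (a <= frac_part x < b).
Proof.
move=> a0 ab b1; rewrite /in_arc; have hx := frac_part_itv x.
have [ax|xa] := leP a (frac_part x).
  rewrite (frac_part_unique (x - a) (Num.floor x)); last first.
    by move: hx ax; rewrite /frac_part; lra.
  by move: hx ax; rewrite /frac_part /= => hx ax; apply/idP/idP; lra.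
rewrite (frac_part_unique (x - a) (Num.floor x - 1)) rmorphB /= mulr1z.
  by apply/negbTE; rewrite -leNgt; move: hx; rewrite /frac_part; lra.
by move: hx xa; rewrite /frac_part; lra.
Qed.

Lemma set_card_norm_ball {R : realType} (g : 'M[R]_2) (r : R) (P : pred 'cV[int]_2)
    (A : set 'cV[int]_2) : g \in unitmx ->
  (forall v, A v <-> image_norm g v <= r /\ P v) ->
  (set_card A)%:R = \sum_(v <- norm_ball g r) (P v)%:R :> R.
Proof.
move=> hg AP; rewrite sum_indicator /set_card; congr (_%:R); congr (#|` _|).
have fA : finite_set A.
  by apply: sub_finite_set (finite_norm_ball g hg r) => v /AP[].
apply/fsetP => v; rewrite in_fset_set // !inE /= in_norm_ball //.
by apply/idP/andP; rewrite inE => /AP.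
Qed.

Theorem theorem40 (R : realType) (g : 'M[R]_2) (hg : g \in unitmx)
    (a b : R) (ha : 0 <= a) (hab : a < b) (hb : b <= 1) :
  (set_card [set v : 'cV[int]_2 | prim_ball g r v /\ a <= frac_part (image_norm g v) < b])%:R /
    (set_card (prim_ball g r))%:R @[r --> +oo] --> b - a.
Proof.
have hl : 0 <= b - a <= 1 by lra.
have [c c0 hc] := primitive_lower_bound g hg.
have hn := primitive_density_null a (b - a) g hl hg.
apply/cvgrPdist_le => e e0; near=> r.
have r1 : 1 <= r by near: r; apply: nbhs_pinfty_ge; rewrite num_real.
have -> : (set_card [set v : 'cV[int]_2 |
      prim_ball g r v /\ a <= frac_part (image_norm g v) < b])%:R
    = \sum_(v <- norm_ball g r) (primitive v && in_arc a (b - a) (image_norm g v))%:R :> R.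
  apply: set_card_norm_ball => // v; rewrite in_arcE ?(ltW hab) //.
  by split=> [[[pv vr] fv]|[vr /andP[pv fv]]]; rewrite ?fv ?andbT.
have -> : (set_card (prim_ball g r))%:R = \sum_(v <- norm_ball g r) (primitive v)%:R :> R.
  by apply: set_card_norm_ball => // v; split=> [[]|[]].
set S := \sum_(v <- _) (_ && _)%:R; set P := \sum_(v <- _) _.
have hP : c * r ^+ 2 <= P by rewrite /P; near: r; exact: hc.
have P0 : 0 < P by rewrite (lt_le_trans _ hP) // mulr_gt0 // exprn_gt0 //; lra.
(* The tolerance is [c * e] because [P] is at least [c * r ^+ 2]; division by [P] then leaves
   [e]. *)
have : `|S - (b - a) * P| <= c * e * r ^+ 2.
  have -> : S - (b - a) * P = \sum_(v <- norm_ball g r)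
      (primitive v)%:R * ((in_arc a (b - a) (image_norm g v))%:R - (b - a)).
    rewrite /S /P mulr_sumr -sumrB; apply: eq_bigr => v _.
    by case: primitive; case: in_arc; rewrite /= ?mulr1n ?mulr0n; ring.
  by near: r; apply: hn; rewrite mulr_gt0.
have -> : b - a - S / P = - ((S - (b - a) * P) / P) by field; rewrite gt_eqF.
rewrite normrN normrM normfV (gtr0_norm P0) ler_pdivrMr // => h; apply: (le_trans h).
by rewrite [c * e]mulrC -mulrA ler_pM2l.
Unshelve. all: by end_near. Qed.
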